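(* Let $P_{s1}>P_{s2}\ge0$, $\Delta P_s=P_{s1}-P_{s2}$, and let $\{X_{1,k}\}_{k=1}^N$ and $\{X_{2,k}\}_{k=1}^N$ be the $2N$ i.i.d. noisy samples (independent, and identically distributed within each of the two sets) of the two-power noisy Rayleigh measurement model described in the context. Then $$\widehat{\sigma}_{H,N}^2=\frac{1}{\Delta P_s}\left(\overline{X_{1,N}^2}-\overline{X_{2,N}^2}\right),\qquad \widehat{\sigma}_{V,N}^2=\frac{1}{\Delta P_s}\left(P_{s1}\overline{X_{2,N}^2}-P_{s2}\overline{X_{1,N}^2}\right)$$ are unbiased maximum likelihood (ML) and minimum variance (MV) estimates for $\sigma_H^2$ and $\sigma_V^2$, respectively, that achieve the Cramér–Rao lower bound. Furthermore, $\overline{X_{1,N}^2}$ and $\overline{X_{2,N}^2}$ are sufficient and complete statistics.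
   Context: Two-power noisy Rayleigh measurement model: the variances $\sigma_H^2$ and $\sigma_V^2$ are unknown and $P_{s1}>P_{s2}\ge0$ are known. For $\ell=1,2$ and $i=1,\dots,N$ ($N$ a positive integer), real (BPSK) symbols $S_{\ell,i}$ with $|S_{\ell,i}|^2=P_{s\ell}$ are transmitted, and one observes $X_{\ell,i}=H_{\ell,i}S_{\ell,i}+V_{\ell,i}$, where the real and imaginary parts of the channel gain $H_{\ell,i}$ are Gaussian with mean $0$ and variance $\sigma_H^2$, the real and imaginary parts of the noise $V_{\ell,i}$ are Gaussian with mean $0$ and variance $\sigma_V^2$, and all these real and imaginary parts (over all $\ell,i$) are mutually independent. Define $\overline{X_{\ell,N}^2}=\frac{1}{2N}\sum_{i=1}^{N}|X_{\ell,i}|^2$ for $\ell=1,2$. The likelihood of the samples, as a function of $(\sigma_H^2,\sigma_V^2)$, is taken to be $$f_X=\prod_{\ell=1}^{2}\frac{1}{(P_{s\ell}\sigma_H^2+\sigma_V^2)^N}\left(\prod_{i=1}^N|X_{\ell,i}|\right)\exp\left\{-\frac{N\,\overline{X_{\ell,N}^2}}{P_{s\ell}\sigma_H^2+\sigma_V^2}\right\}.$$ ML estimates are those that maximize $f_X$. With $\theta=(\sigma_H^2,\sigma_V^2)^T$, the Fisher information matrix is $\mathbb{E}\left[\frac{\partial\ln f_X}{\partial\theta}\left(\frac{\partial\ln f_X}{\partial\theta}\right)^T\right]$; its inverse is the Cramér–Rao lower bound, i.e. the smallest error covariance achievable by unbiased estimators, and achieving the bound means that the error covariance matrix of $(\widehat{\sigma}_{H,N}^2,\widehat{\sigma}_{V,N}^2)$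 equals this inverse.
   Formalization: Maximum likelihood is stated almost surely, with f_X maximized over all real pairs with P_{sℓ}σ_H²+σ_V²>0 for ℓ=1,2: the estimates can be negative, so they need not maximize over nonnegative variances, and over the whole plane f_X can be unbounded. Both true variances are taken positive. *)

(* Defs.v *)
From HB Require Import structures.
From mathcomp Require Import all_boot all_order all_algebra.
From mathcomp Require Import all_classical all_reals all_analysis.
From mathcomp Require Import complex.

Set Implicit Arguments.
Unset Strict Implicit.
Unset Printing Implicit Defensive.

Import Order.TTheory GRing.Theory Num.Theory.
Import numFieldNormedType.Exports.
Local Open Scope classical_set_scope.
Local Open Scope ring_scope.

Definition gaussian d (T : measurableType d) (R : realType)
    (P : probability T R) (m s2 : R) (Y : T -> R) : Prop :=
  measurable_fun setT Y /\
  forall A : set R, measurable A ->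
    P (Y @^-1` A) = normal_prob m (Num.sqrt s2) A.

Definition mutually_independent d (T : measurableType d) (R : realType)
    (P : probability T R) (I : finType) (Y : I -> T -> R) : Prop :=
  forall (J : {set I}) (A : I -> set R), (forall i, measurable (A i)) ->
    (P (\bigcap_(i in [set` J]) (Y i @^-1` A i)) =
     \prod_(i in J) P (Y i @^-1` A i))%E.

(** The parameter is the column vector t = (sigma_H^2, sigma_V^2)^T, and the
    elements ord0, ord_max of 'I_2 stand for l = 1, 2. *)

Definition sigma2H (R : realType) (t : 'cV[R]_2) : R := t ord0 ord0.
Definition sigma2V (R : realType) (t : 'cV[R]_2) : R := t ord_max ord0.

Definition true_params (R : realType) : set 'cV[R]_2 :=
  [set t | 0 < sigma2H t /\ 0 < sigma2V t].

Definition re_im (R : realType) (im : bool) (z : R[i]) : R :=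
  if im then complex.Im z else complex.Re z.

(** The real and imaginary parts of all gains (false) and noises (true), as one
    finite family of real random variables. *)
Definition parts T (R : realType) N (H V : 'I_2 -> 'I_N -> T -> R[i])
    (k : (bool * bool) * ('I_2 * 'I_N)) (w : T) : R :=
  let: ((noise, im), (l, i)) := k in
  re_im im ((if noise then V else H) l i w).

Definition received T (R : realType) N (S : 'I_2 -> 'I_N -> R)
    (H V : 'I_2 -> 'I_N -> T -> R[i]) (w : T) : 'I_2 -> 'I_N -> R[i] :=
  fun l i => H l i w * (S l i)%:C%C + V l i w.

Definition mean_square (R : realType) N (x : 'I_2 -> 'I_N -> R[i])
    (l : 'I_2) : R :=
  (2 * N)%:R^-1 * \sum_(i < N) ComplexField.Normc.normc (x l i) ^+ 2.

(** Mean of [mean_square x l]: variance of each of the two real coordinates of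
    the l-th group of samples. *)
Definition power (R : realType) (Ps : 'I_2 -> R) (t : 'cV[R]_2) (l : 'I_2) : R :=
  Ps l * sigma2H t + sigma2V t.

(** Joint Rayleigh density of the amplitudes |x l i|. *)
Definition likelihood (R : realType) N (Ps : 'I_2 -> R)
    (x : 'I_2 -> 'I_N -> R[i]) (t : 'cV[R]_2) : R :=
  \prod_(l < 2) ((power Ps t l ^+ N)^-1
                 * (\prod_(i < N) ComplexField.Normc.normc (x l i))
                 * expR (- (N%:R * mean_square x l / power Ps t l))).

(** The estimate of sigma_H^2 is negative with positive probability, so the
    likelihood is maximised over all pairs for which it is a product of
    densities, not only over pairs of positive reals. *)
Definition likelihood_domain (R : realType) (Ps : 'I_2 -> R) : set 'cV[R]_2 :=
  [set t | forall l, 0 < power Ps t l].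

Definition is_ml_estimate (R : realType) N (Ps : 'I_2 -> R)
    (x : 'I_2 -> 'I_N -> R[i]) (t : 'cV[R]_2) : Prop :=
  likelihood_domain Ps t /\
  forall u, likelihood_domain Ps u -> likelihood Ps x u <= likelihood Ps x t.

Definition sigma2H_hat (R : realType) N (Ps : 'I_2 -> R)
    (x : 'I_2 -> 'I_N -> R[i]) : R :=
  (Ps ord0 - Ps ord_max)^-1 * (mean_square x ord0 - mean_square x ord_max).

Definition sigma2V_hat (R : realType) N (Ps : 'I_2 -> R)
    (x : 'I_2 -> 'I_N -> R[i]) : R :=
  (Ps ord0 - Ps ord_max)^-1 *
  (Ps ord0 * mean_square x ord_max - Ps ord_max * mean_square x ord0).

Definition theta_hat (R : realType) N (Ps : 'I_2 -> R)
    (x : 'I_2 -> 'I_N -> R[i]) : 'cV[R]_2 :=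
  \col_(k < 2) (if k == ord0 then sigma2H_hat Ps x else sigma2V_hat Ps x).

Definition expected_mx d (T : measurableType d) (R : realType)
    (P : probability T R) m n (M : T -> 'M[R]_(m, n)) : 'M[R]_(m, n) :=
  \matrix_(i, j) fine ('E_P[(fun w => M w i j)])%E.

Definition integrable_mx d (T : measurableType d) (R : realType)
    (P : probability T R) m n (M : T -> 'M[R]_(m, n)) : Prop :=
  forall i j, P.-integrable setT (fun w => (M w i j)%:E).

Definition score (R : realType) N (Ps : 'I_2 -> R)
    (x : 'I_2 -> 'I_N -> R[i]) (t : 'cV[R]_2) : 'cV[R]_2 :=
  \col_(k < 2) 'D_(delta_mx k ord0) (fun u => ln (likelihood Ps x u)) t.

(** [expected_mx] is only meaningful for integrable matrices and [invmx] for
    invertible ones, whence the side conditions. *)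
Definition attains_cramer_rao d (T : measurableType d) (R : realType)
    (P : probability T R) N (Ps : 'I_2 -> R) (X : T -> 'I_2 -> 'I_N -> R[i])
    (t : 'cV[R]_2) (est : T -> 'cV[R]_2) : Prop :=
  let score2 w := score Ps (X w) t *m (score Ps (X w) t)^T in
  let error2 w := (est w - t) *m (est w - t)^T in
  [/\ integrable_mx P score2, integrable_mx P error2,
      expected_mx P score2 \in unitmx
    & expected_mx P error2 = invmx (expected_mx P score2)].

(** The sigma-algebra generated by the samples is [<<s sample_events X >>]:
    estimators and statistics, i.e. Borel functions of the samples, are the
    maps that are measurable for it. *)
Definition sample_events T (R : realType) N (X : T -> 'I_2 -> 'I_N -> R[i]) :
    set (set T) :=
  [set A | exists (im : bool) (l : 'I_2) (i : 'I_N) (B : set R),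
     measurable B /\ A = (fun w => re_im im (X w l i)) @^-1` B].

Definition is_statistic d (T : measurableType d) (R : realType) N
    (X : T -> 'I_2 -> 'I_N -> R[i]) d' (S : measurableType d')
    (Y : T -> S) : Prop :=
  forall B : set S, measurable B -> <<s sample_events X >> (Y @^-1` B).

Definition unbiased d (T : measurableType d) (R : realType)
    (P : 'cV[R]_2 -> probability T R) (g : 'cV[R]_2 -> R) (U : T -> R) : Prop :=
  forall t, true_params t ->
    (P t).-integrable setT (fun w => (U w)%:E) /\ ('E_(P t)[U] = (g t)%:E)%E.

Definition is_mv_estimate d (T : measurableType d) (R : realType)
    (P : 'cV[R]_2 -> probability T R) N (X : T -> 'I_2 -> 'I_N -> R[i])
    (g : 'cV[R]_2 -> R) (U : T -> R) : Prop :=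
  [/\ is_statistic X U, unbiased P g U
    & forall W : T -> R, is_statistic X W -> unbiased P g W ->
        forall t, true_params t -> ('V_(P t)[U] <= 'V_(P t)[W])%E].

(** Every event A of the samples has a version k o Y of P_t(A | Y) that does
    not depend on t. *)
Definition sufficient_statistic d (T : measurableType d) (R : realType)
    (P : 'cV[R]_2 -> probability T R) N (X : T -> 'I_2 -> 'I_N -> R[i])
    d' (S : measurableType d') (Y : T -> S) : Prop :=
  is_statistic X Y /\
  forall A, <<s sample_events X >> A ->
    exists2 k : S -> R, measurable_fun setT k &
      forall t, true_params t ->
        (P t).-integrable setT (fun w => (k (Y w))%:E) /\
        forall B : set S, measurable B ->
          (P t (A `&` Y @^-1` B) = \int[P t]_(w in Y @^-1` B) (k (Y w))%:E)%E.

Definition complete_statistic d (T : measurableType d) (R : realType)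
    (P : 'cV[R]_2 -> probability T R) N (X : T -> 'I_2 -> 'I_N -> R[i])
    d' (S : measurableType d') (Y : T -> S) : Prop :=
  is_statistic X Y /\
  forall g : S -> R, measurable_fun setT g ->
    (forall t, true_params t ->
       (P t).-integrable setT (fun w => (g (Y w))%:E) /\
       ('E_(P t)[g \o Y] = 0)%E) ->
    forall t, true_params t -> {ae P t, forall w, g (Y w) = 0}.

(* Main.v *)
(** Each real coordinate of the l-th group of samples is centred Gaussian with
    variance [power Ps t l], and the 4N coordinates are independent.  Hence the law
    of the samples under one parameter has, with respect to the law under another,
    a density of the form [C * expR (- (a_1 m_1 + a_2 m_2))], where the [m_l] are the
    mean squares.  Sufficiency follows by transporting through this density a
    version of the conditional probability under one fixed parameter.

    Completeness and minimum variance both come from one fact: a statistic [D] with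
    zero mean under all parameters has zero integral over every event of
    [(m_1, m_2)].  The reciprocals of the powers range over an open convex cone, so
    [D] has zero joint moments against the bounded variables
    [expR (- v_k . (m_1, m_2))] for two independent directions [v_1], [v_2] in the
    cone, and a finite signed measure on the unit square with zero moments is
    zero.  Applied to the difference [D] of two unbiased estimates, it makes [D]
    orthogonal to the linear estimate.

    The score and the estimation error are both linear in the centred mean squares,
    whose covariance is diagonal with entries [power Ps t l ^+ 2 / N]; the
    Cramer-Rao equality is then an identity between 2 x 2 matrices. *)

Require Import Defs.
From HB Require Import structures.
From mathcomp Require Import all_boot all_order all_algebra.
From mathcomp Require Import all_classical all_reals all_analysis.
From mathcomp Require Import complex.
From mathcomp Require Import measurable_realfun ring lra.

Set Implicit Arguments.
Unset Strict Implicit.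
Unset Printing Implicit Defensive.

Import Order.TTheory GRing.Theory Num.Theory.
Import numFieldNormedType.Exports.
Local Open Scope classical_set_scope.
Local Open Scope ring_scope.

(** * Densities and image measures *)

(** The space [T] is arbitrary and only events of the samples have the stated density, so every
    change of parameter is confined to statistics. Since that density is a function of [(m_1, m_2)]
    alone, the zero-mean fact holds for every statistic [D], not only for functions of [(m_1, m_2)].
    Minimum variance over all unbiased estimates therefore follows without conditioning on the mean
    squares.

    In reciprocal powers [(r_1, r_2)] the positive parameters form the cone
    [(P_s2 / P_s1) r_2 < r_1 < r_2]. Both directions are taken inside it, so a true parameter stays
    true when nonnegative multiples of them are added.

    The linear estimates are unbounded and [D] is only known to be integrable. Orthogonality is thus
    obtained on events first, as equality of the images of the measures with densities [D^+] and
    [D^-], and extended afterwards to products known to be integrable.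

    Where some amplitude is zero the likelihood vanishes for every parameter. This null event is why
    the maximum likelihood claim holds almost surely, and why the score needs a separate case
    there. *)

Section density_measure.
Local Open Scope ereal_scope.
Context d (T : measurableType d) (R : realType).
Variables (mu : {measure set T -> \bar R}) (h : T -> R).
Hypotheses (mh : measurable_fun [set: T] h) (h0 : forall x, (0 <= h x)%R).

(** The two proofs are arguments so that the measure instance below can be inferred from the term
    [mdensity mh h0]. *)
Definition mdensity of measurable_fun [set: T] h & (forall x, (0 <= h x)%R) :=
  fun A : set T => \int[mu]_(x in A) (h x)%:E.

Let mdensity0 : mdensity mh h0 set0 = 0.
Proof. by rewrite /mdensity integral_set0. Qed.

Let mdensity_ge0 A : 0 <= mdensity mh h0 A.
Proof. by apply: integral_ge0 => x _; rewrite lee_fin. Qed.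

Let mdensity_sigma_additive : semi_sigma_additive (mdensity mh h0).
Proof.
move=> F mF tF mUF; rewrite /mdensity ge0_integral_bigcup//.
- by apply: is_cvg_ereal_nneg_natsum => n _; exact: mdensity_ge0.
- by apply/measurable_funTS/measurable_EFinP.
- by move=> x _; rewrite lee_fin.
Qed.

HB.instance Definition _ := isMeasure.Build _ _ _
  (mdensity mh h0) mdensity0 mdensity_ge0 mdensity_sigma_additive.

Import HBNNSimple.

Lemma ge0_integral_mdensity (f : T -> \bar R) :
  measurable_fun [set: T] f -> (forall x, 0 <= f x) ->
  \int[mdensity mh h0]_x f x = \int[mu]_x (f x * (h x)%:E).
Proof.
move=> mf f0; pose g := nnsfun_approx measurableT mf.
have gf x : f x = limn (EFin \o g ^~ x).
  by apply/esym/cvg_lim => //; exact: cvg_nnsfun_approx.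
have mh' : measurable_fun [set: T] (EFin \o h) by exact/measurable_EFinP.
transitivity (limn (fun n => \int[mdensity mh h0]_x (g n x)%:E)).
  rewrite -monotone_convergence//.
  - by apply: eq_integral => x _; rewrite gf.
  - by move=> n; exact/measurable_EFinP.
  - by move=> n x _; rewrite lee_fin.
  - by move=> x _ m n mn; rewrite lee_fin; exact/lefP/nd_nnsfun_approx.
have -> : \int[mu]_x (f x * (h x)%:E) =
    limn (fun n => \int[mu]_x ((g n x)%:E * (h x)%:E)).
  rewrite -monotone_convergence//.
  - apply: eq_integral => x _; apply/esym/cvg_lim => //.
    by apply: cvgeZr => //; exact: cvg_nnsfun_approx.
  - by move=> n; apply: emeasurable_funM => //; exact/measurable_EFinP.
  - by move=> n x _; rewrite -EFinM lee_fin mulr_ge0.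
  - move=> x _ m n mn; rewrite -!EFinM lee_fin ler_wpM2r//.
    exact/lefP/nd_nnsfun_approx.
congr (limn _); apply/funext => n.
rewrite integral_nnsfun//= patch_setT sintegralE.
transitivity (\int[mu]_x ((\sum_(y \in range (g n))
    (y * \1_(g n @^-1` [set y]) x)%:E) * (h x)%:E)); last first.
  by apply: eq_integral => x _; rewrite [in RHS]fimfunE -fsumEFin.
under [RHS]eq_integral do
  (rewrite ge0_mule_fsuml; last by move=> y; exact: nnfun_muleindic_ge0).
rewrite ge0_integral_fsum//; last 2 first.
  - move=> y; apply: emeasurable_funM => //; apply/measurable_EFinP.
    exact: measurable_funM.
  - by move=> y x _; rewrite mule_ge0 ?lee_fin// -lee_fin EFinM nnfun_muleindic_ge0.
apply: eq_fsbigr => r; rewrite inE => -[x0 _ <-].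
under [RHS]eq_integral do rewrite EFinM -muleA.
rewrite ge0_integralZl//; last 3 first.
  - apply: emeasurable_funM => //; exact/measurable_EFinP.
  - by move=> x _; rewrite mule_ge0// lee_fin.
  - by rewrite lee_fin.
congr (_ * _); rewrite /mdensity.
under [RHS]eq_integral do rewrite muleC.
rewrite [LHS]integral_mkcond; apply: eq_integral => x _.
by rewrite epatch_indic.
Qed.

End density_measure.

Section pushforward_bundled.
Context d d' (T : measurableType d) (S : measurableType d') (R : realType).
Variables (mu : {measure set T -> \bar R}) (Y : T -> S).
Hypothesis mY : measurable_fun [set: T] Y.

Definition mpushforward : {measure set S -> \bar R} :=
  measure_function_pushforward__canonical__measure_function_Measure mu mY.

Lemma mpushforwardE A : mpushforward A = mu (Y @^-1` A).
Proof. by []. Qed.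

Lemma ge0_integral_mpushforward (f : S -> \bar R) :
  measurable_fun [set: S] f -> (forall y, 0 <= f y)%E ->
  (\int[mpushforward]_y f y = \int[mu]_x f (Y x))%E.
Proof. by move=> mf f0; exact: (@ge0_integral_pushforward _ _ _ _ _ _ mY _ setT). Qed.

End pushforward_bundled.

(** The transport principle behind every change of measure below: [m1] and [m2] may differ on other
    events, but integrals of functions of [Y] see only the image measures. *)
Lemma eq_ge0_integral_comp d d' (T : measurableType d) (S : measurableType d')
    (R : realType) (m1 m2 : {measure set T -> \bar R}) (Y : T -> S)
    (f : S -> \bar R) :
  measurable_fun [set: T] Y ->
  (forall B, measurable B -> m1 (Y @^-1` B) = m2 (Y @^-1` B)) ->
  measurable_fun [set: S] f -> (forall y, 0 <= f y)%E ->
  (\int[m1]_x f (Y x) = \int[m2]_x f (Y x))%E.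
Proof.
move=> mY m12 mf f0; rewrite -!(ge0_integral_mpushforward _ mY)//.
by apply: eq_measure_integral => A mA _; exact: m12.
Qed.

Lemma ge0_integral_fin_integrable d (T : measurableType d) (R : realType)
    (mu : {measure set T -> \bar R}) (f : T -> R) (c : R) :
  measurable_fun [set: T] f -> (forall x, 0 <= f x) ->
  (\int[mu]_x (f x)%:E = c%:E)%E -> mu.-integrable [set: T] (EFin \o f).
Proof.
move=> mf f0 fc; apply/integrableP; split; first exact/measurable_EFinP.
by under eq_integral do rewrite gee0_abs ?lee_fin//; rewrite fc ltry.
Qed.

(** * Independent families *)

Section independent_laws.
Context d d' (T : measurableType d) (S : measurableType d') (R : realType).
Variables (P : probability T R) (I : finType) (Z : I -> T -> S).
Variable nu : I -> probability S R.
Hypothesis mZ : forall i, measurable_fun [set: T] (Z i).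

Definition independent_with_laws (G : set (set S)) :=
  forall E : I -> set S, (forall i, G (E i)) ->
    (P [set w | forall i, E i (Z i w)] = \prod_(i in I) nu i (E i))%E.

Let measurable_cylinder (D : {pred I}) (E : I -> set S) :
  (forall i, measurable (E i)) ->
  measurable [set w | forall i, i \in D -> E i (Z i w)].
Proof.
move=> mE.
rewrite (_ : [set w | _] = \bigcap_(i in [set i | i \in D]) (Z i @^-1` E i)).
  apply: fin_bigcap_measurable => // i _.
  by rewrite -[X in measurable X]setTI; exact: mZ.
by rewrite eqEsubset; split=> w h i; exact: h.
Qed.

Let prob_fin_num (m : probability S R) (F : set S) : measurable F ->
  m F = (fine (m F))%:E.
Proof. by move=> mF; rewrite fineK// fin_num_measure. Qed.

(** A pi-system argument, one coordinate at a time: with the other sets fixed, both sides are finite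
    measures in the set of coordinate [j], and they agree on [G]. *)
Lemma independent_with_laws_generator (G : set (set S)) :
  measurable = <<s G >> -> setI_closed G -> G setT ->
  independent_with_laws G -> independent_with_laws measurable.
Proof.
move=> mG GI GT indG E mE.
have Gm F : G F -> measurable F by rewrite mG; exact: sub_sigma_algebra.
(* [K] collects the coordinates whose set is an arbitrary measurable one; the others are still in
   [G]. *)
suff: forall n (K : {set I}) E', #|K| = n -> (forall i, measurable (E' i)) ->
    (forall i, i \notin K -> G (E' i)) ->
    (P [set w | forall i, E' i (Z i w)] = \prod_(i in I) nu i (E' i))%E.
  by move=> /(_ _ [set: I]%SET E erefl); apply => // i; rewrite inE.
elim=> [|n IH] K {mE}E Kn mE GE.
  apply: indG => i; apply: GE.
  by move/eqP: Kn; rewrite cards_eq0 => /eqP ->; rewrite inE.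
have [j jK] : exists j, j \in K.
  by apply/set0Pn; rewrite -card_gt0 Kn.
pose E' (F : set S) i := if i == j then F else E i.
have mA : measurable [set w | forall i, i \in predC1 j -> E i (Z i w)].
  exact: measurable_cylinder.
have A0 F : [set w | forall i, E' F i (Z i w)] =
    Z j @^-1` F `&` [set w | forall i, i \in predC1 j -> E i (Z i w)].
  rewrite eqEsubset; split => w /=.
    move=> h; split; first by have := h j; rewrite /E' eqxx.
    by move=> i; rewrite !inE => ij; have := h i; rewrite /E' (negbTE ij).
  move=> [hj h] i; rewrite /E'; have [->//|ij] := eqVneq.
  by apply: h; rewrite !inE.
pose c := (\prod_(i in I | i != j) fine (nu i (E i)))%R.
have c0 : (0 <= c)%R by apply: prodr_ge0 => i _; exact: fine_ge0.
have prodE F : measurable F ->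
    (\prod_(i in I) nu i (E' F i) = c%:E * nu j F)%E.
  move=> mF; rewrite (bigD1 j)//= muleC; congr (_ * _)%E; last first.
    by rewrite /E' eqxx.
  rewrite /c -prodEFin; apply: eq_bigr => i ij.
  by rewrite /E' (negbTE ij) -prob_fin_num.
pose m1 := mpushforward (mrestr P mA) (mZ j).
pose m2 := mscale (NngNum c0) (nu j).
have EE : E = E' (E j).
  by apply/funext => i; rewrite /E'; have [->|] := eqVneq.
rewrite EE A0 prodE//.
apply: (@measure_unique _ _ _ G (fun=> setT) mG GI (fun=> GT) _ m1 m2) => //.
- by rewrite bigcup_const//; exists 0%N.
- move=> F GF; rewrite /m1 /m2 mpushforwardE /= /mrestr/mscale/= -A0 -prodE//.
    apply: (IH (K :\ j)) => //.
    + by move: Kn; rewrite (cardsD1 j) jK => -[].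
    + by move=> i; rewrite /E'; case: ifP => // _; exact: Gm.
    + move=> i; rewrite in_setD1 /E'; case: eqP => //= _; exact: GE.
  exact: Gm.
- move=> _; rewrite /m1 mpushforwardE /= /mrestr.
  apply: (@le_lt_trans _ _ (P setT)); last by rewrite probability_setT ltry.
    apply: le_measure; rewrite ?inE//; apply: measurableI => //.
  by rewrite -[X in measurable X]setTI; exact: mZ.
Qed.

Hypothesis indep : independent_with_laws measurable.

(** Indicators are replaced by general factors one at a time. The image under [Z j] of [P] weighted
    by the other factors is a multiple of [nu j]; the induction hypothesis tests this on indicators,
    and then [f j] is integrated against both measures. *)
Lemma ge0_integral_prod_independent (f : I -> S -> R) (c : I -> R) :
  (forall i, measurable_fun [set: S] (f i)) -> (forall i x, 0 <= f i x) ->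
  (forall i, \int[nu i]_x (f i x)%:E = (c i)%:E)%E ->
  (\int[P]_w (\prod_(i in I) f i (Z i w))%:E = (\prod_(i in I) c i)%:E)%E.
Proof.
move=> mf f0 fc.
suff: forall n (K : {set I}) (f : I -> S -> R) (c : I -> R), #|K| = n ->
  (forall i, measurable_fun [set: S] (f i)) -> (forall i x, 0 <= f i x) ->
  (forall i, \int[nu i]_x (f i x)%:E = (c i)%:E)%E ->
    (forall i, i \notin K -> exists2 E, measurable E & f i = \1_E) ->
  (\int[P]_w (\prod_(i in I) f i (Z i w))%:E = (\prod_(i in I) c i)%:E)%E.
  by move=> /(_ _ [set: I]%SET f c erefl); apply => // i; rewrite inE.
elim=> [|n IH] K {mf f0 fc}f {}c Kn mf f0 fc iE.
  have iE' i : {E | measurable E & f i = \1_E}.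
    apply: cid2; apply: iE.
    by move/eqP: Kn; rewrite cards_eq0 => /eqP ->; rewrite inE.
  pose E i := s2val (iE' i).
  have mE i : measurable (E i) by rewrite /E; case: (iE' i).
  have fE i : f i = \1_(E i) by rewrite /E; case: (iE' i).
  transitivity (\int[P]_w (\1_[set w | forall i, E i (Z i w)] w)%:E)%E.
    apply: eq_integral => w _; congr EFin.
    under eq_bigr do rewrite fE indicE.
    rewrite indicE; case: (asboolP (forall i, E i (Z i w))) => h.
      rewrite mem_set//= big1// => i _.
      by rewrite mem_set//; exact: h.
    rewrite memNset//=; have [i hi] := (existsNP _).2 h.
    by rewrite (bigD1 i)//= memNset//= mul0r.
  rewrite integral_indic// ?setIT.
    transitivity (\prod_(i in I) nu i (E i))%E; first exact: indep.
    rewrite -prodEFin; apply: eq_bigr => i _; rewrite -fc fE.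
    by rewrite integral_indic// setIT.
  rewrite (_ : mkset _ = [set w | forall i, i \in I -> E i (Z i w)]).
    exact: measurable_cylinder.
  by rewrite eqEsubset; split=> w h i; [move=> _|]; exact: h.
have [j jK] : exists j, j \in K.
  by apply/set0Pn; rewrite -card_gt0 Kn.
pose H w := \prod_(i in I | i != j) f i (Z i w).
have mH : measurable_fun [set: T] H.
  rewrite /H; under eq_fun do rewrite big_mkcond/=.
  apply: measurable_prod => i /= _; case: (i != j) => _; last exact: measurable_cst.
  exact: measurableT_comp.
have H0 w : 0 <= H w by exact: prodr_ge0.
pose C := (\prod_(i in I | i != j) c i)%R.
have c_ge0 i : 0 <= c i.
  by rewrite -lee_fin -fc; apply: integral_ge0 => x _; rewrite lee_fin.
have C0 : 0 <= C by exact: prodr_ge0.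
pose m1 := mpushforward (mdensity P mH H0) (mZ j).
pose m2 := mscale (NngNum C0) (nu j).
have m12 F : measurable F -> m1 F = m2 F.
  move=> mF; rewrite /m1 mpushforwardE /m2/= /mdensity/= /mscale/=.
  (* With the indicator of [F] as factor [j], the index [j] leaves [K], so the induction hypothesis
     evaluates [m1 F]. *)
  pose f' i := if i == j then \1_F else f i.
  pose c' i := if i == j then fine (nu j F) else c i.
  transitivity (\int[P]_w (\prod_(i in I) f' i (Z i w))%:E)%E.
    rewrite integral_mkcond; apply: eq_integral => w _.
    rewrite [in RHS](bigD1 j)//= {1}/f' eqxx.
    rewrite (_ : \prod_(i | i != j) _ = H w); last first.
      by apply: eq_bigr => i ij; rewrite /f' (negbTE ij).
    rewrite patchE indicE; have [hF|hF] := pselect (F (Z j w)).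
      by rewrite !mem_set// mul1r.
    by rewrite !memNset// mul0r.
  rewrite (IH (K :\ j)%SET f' c').
  - rewrite (bigD1 j)//= {1}/c' eqxx muleC EFinM -prob_fin_num//; congr (_ * _%:E)%E.
    by apply: eq_bigr => i ij; rewrite /c' (negbTE ij).
  - by move: Kn; rewrite (cardsD1 j) jK => -[].
  - by move=> i; rewrite /f'; case: ifP => // _; exact: measurable_indic.
  - by move=> i x; rewrite /f'; case: ifP => // _; rewrite indicE.
  - move=> i; rewrite /f' /c'; have [->|//] := eqVneq.
    by rewrite integral_indic// setIT -prob_fin_num.
  - move=> i; rewrite in_setD1 /f'; case: eqP => //= _ iK; last exact: iE.
    by exists F.
transitivity (\int[m1]_x (f j x)%:E)%E.
  rewrite ge0_integral_mpushforward ?ge0_integral_mdensity//.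
  - apply: eq_integral => w _.
    by rewrite -EFinM (bigD1 j).
  - by apply/measurable_EFinP; exact: measurableT_comp.
  - by move=> w; rewrite lee_fin.
  - exact/measurable_EFinP.
  - by move=> w; rewrite lee_fin.
rewrite (eq_measure_integral m2); last by move=> A mA _; exact: m12.
rewrite /m2 ge0_integral_mscale//=; last 2 first.
  exact/measurable_EFinP.
  by move=> x _; rewrite lee_fin.
by rewrite fc (bigD1 j)//= muleC EFinM.
Qed.

End independent_laws.

(** * Gaussian laws *)

Section gaussian_laws.
Variable R : realType.
Implicit Types (a b c m s x : R).

Notation mu := (@lebesgue_measure R).

Lemma lebesgue_measure_shift a (A : set R) : measurable A ->
  mu ((fun x => x + a) @^-1` A) = mu A.
Proof.
move=> mA.
have ma : @measurable_fun _ _ (measurableTypeR R) (measurableTypeR R) setT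
  (fun x : R => x + a) by exact: measurable_funD.
apply/esym; rewrite -(mpushforwardE mu ma).
apply: (@lebesgue_measure_unique R (mpushforward mu ma)); last exact: mA.
move=> _ [[x y] _ <-] /=.
rewrite /pushforward (_ : _ @^-1` _ = `]x - a, y - a]%classic); last first.
  by apply/seteqP; split => z /=; rewrite !in_itv/= ltrBlDr lerBrDr.
by rewrite !lebesgue_measure_itv/= !lte_fin ltrD2r; case: ifPn => // _;
  rewrite -!EFinD; congr EFin; ring.
Qed.

Lemma ge0_integral_shift a (f : R -> \bar R) : measurable_fun [set: R] f ->
  (forall x, 0 <= f x)%E -> (\int[mu]_x f ((x : R) + a)%R = \int[mu]_x f x)%E.
Proof.
move=> mf f0.
have ma : @measurable_fun _ _ (measurableTypeR R) (measurableTypeR R) setT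
  (fun x : R => x + a) by exact: measurable_funD.
rewrite -(ge0_integral_mpushforward mu ma)//.
by apply: eq_measure_integral => A mA _; exact: lebesgue_measure_shift.
Qed.

Lemma normal_probE m s (B : set R) : measurable B ->
  normal_prob m s B = (\int[mu]_x (\1_B x * normal_pdf m s x)%:E)%E.
Proof.
move=> mB; rewrite /normal_prob integral_mkcond; apply: eq_integral => x _.
by rewrite patchE indicE; case: ifP => _; rewrite ?mul1r ?mul0r.
Qed.

(** [normal_prob] unfolds to the measure of density [normal_pdf], so the general lemma applies by
    conversion. *)
Lemma ge0_integral_normal_prob m s (f : R -> \bar R) :
  measurable_fun [set: R] f -> (forall x, 0 <= f x)%E ->
  (\int[normal_prob m s]_x f x = \int[mu]_x (f x * (normal_pdf m s x)%:E))%E.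
Proof.
exact: (@ge0_integral_mdensity _ (measurableTypeR R) R mu _
  (measurable_normal_pdf m s) (normal_pdf_ge0 m s)).
Qed.

Lemma normal_prob_shift m s (B : set R) : s != 0 -> measurable B ->
  normal_prob 0 s ((fun v => v + m) @^-1` B) = normal_prob m s B.
Proof.
move=> s0 mB; have mB' : measurable ((fun v => v + m) @^-1` B).
  rewrite -[X in measurable X]setTI.
  by apply: (@measurable_funD _ _ _ setT id (cst m)).
rewrite (normal_probE 0 s mB') (normal_probE m s mB).
rewrite -[RHS](ge0_integral_shift m); last 2 first.
- apply/measurable_EFinP/measurable_funM; first exact: measurable_indic.
  exact: measurable_normal_pdf.
- by move=> x; rewrite lee_fin mulr_ge0// normal_pdf_ge0.
apply: eq_integral => x _; congr (_ * _)%:E.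
by rewrite !normal_pdfE// /normal_fun addrK subr0.
Qed.

Lemma normal_peakE s : 0 < s -> normal_peak s = (s * Num.sqrt (pi *+ 2))^-1.
Proof.
move=> s0; rewrite /normal_peak -mulrnAr sqrtrM ?sqr_ge0//.
by rewrite sqrtr_sqr gtr0_norm.
Qed.

(* Completing the square: the conditional law of a component given the sum. *)
Lemma normal_pdfM s a b c u x : 0 < a -> 0 < b -> 0 < c ->
  c ^+ 2 = s ^+ 2 * a ^+ 2 + b ^+ 2 ->
  normal_pdf 0 a u * normal_pdf (s * u) b x =
  normal_pdf 0 c x * normal_pdf (s * a ^+ 2 * x / c ^+ 2) (a * b / c) u.
Proof.
move=> a0 b0 c0 cE; have abc0 : 0 < a * b / c by rewrite divr_gt0// mulr_gt0.
rewrite !normal_pdfE ?gt_eqF// !normal_peakE// /normal_fun.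
set r := Num.sqrt (pi *+ 2).
have r0 : 0 < r by rewrite sqrtr_gt0 mulrn_wgt0// pi_gt0.
rewrite mulrACA -expRD [in RHS]mulrACA -expRD; congr (_ * expR _).
  rewrite -!invfM; congr _^-1.
  by rewrite mulrACA [RHS]mulrACA; congr (_ * _); rewrite [RHS]mulrC divfK ?gt_eqF.
rewrite !subr0.
apply/eqP; rewrite -subr_eq0; apply/eqP.
have c2 : c ^+ 2 != 0 by rewrite expf_neq0// gt_eqF.
have {1}-> : (u - s * a ^+ 2 * x / c ^+ 2) = (u * c ^+ 2 - s * a ^+ 2 * x) / c ^+ 2.
  by field; rewrite gt_eqF.
rewrite [(a * b / c) ^+ 2]expr_div_n cE; rewrite cE in c2.
field; do ?[apply/andP; split]; rewrite ?gt_eqF//.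
by rewrite ltr_wpDl ?sqr_ge0// exprn_gt0.
Qed.

(** Tonelli and completion of the square: once the integrals are swapped, the inner one is that of a
    normal density. The factor [s] may be negative or zero, as a BPSK symbol has either sign and
    vanishes when its power is 0. *)
Lemma normal_prob_conv s a b c (B : set R) : 0 < a -> 0 < b -> 0 < c ->
  c ^+ 2 = s ^+ 2 * a ^+ 2 + b ^+ 2 -> measurable B ->
  (normal_prob 0 a \x normal_prob 0 b)%E [set z | B (s * z.1 + z.2)] =
  normal_prob 0 c B.
Proof.
move=> a0 b0 c0 cE mB; rewrite /product_measure1.
have b'0 : b != 0 by rewrite gt_eqF.
have mF : measurable_fun [set: R * R]
    (fun z => (\1_B z.2 * (normal_pdf 0 a z.1 * normal_pdf (s * z.1) b z.2))).
  apply: measurable_funM.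
    by apply: (measurableT_comp (measurable_indic mB)).
  apply: measurable_funM.
    exact: (measurableT_comp (measurable_normal_pdf 0 a)).
  rewrite (_ : (fun _ => _) = fun z : R * R =>
      normal_peak b * expR (- (z.2 - s * z.1) ^+ 2 / (b ^+ 2 *+ 2))); last first.
    by apply/funext => z; rewrite normal_pdfE.
  apply: measurable_funM => //; apply: measurableT_comp => //.
  apply: measurable_funM => //; apply: measurableT_comp => //.
  apply: measurable_funX; apply: measurable_funB => //.
  exact: measurable_funM.
transitivity (\int[normal_prob 0 a]_u normal_prob (s * u) b B)%E.
  apply: eq_integral => u _.
  have E : xsection [set z : R * R | B (s * z.1 + z.2)] u =
      (fun v => v + s * u) @^-1` B.
    by apply/seteqP; split => v; rewrite /xsection/= inE/= addrC.
  rewrite [LHS]/comp E; exact: normal_prob_shift.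
transitivity (\int[mu]_u \int[mu]_x
    (\1_B x * (normal_pdf 0 a u * normal_pdf (s * u) b x))%:E)%E.
  rewrite ge0_integral_normal_prob//; last first.
    under eq_fun do rewrite normal_probE//.
    apply: (@measurable_fun_fubini_tonelli_F _ _ R (measurableTypeR R) R mu
      (fun z : R * R => (\1_B z.2 * normal_pdf (s * z.1) b z.2)%:E)).
      apply/measurable_EFinP.
      apply: measurable_funM.
        by apply: (measurableT_comp (measurable_indic mB)).
      rewrite (_ : (fun _ => _) = fun z : R * R =>
          normal_peak b * expR (- (z.2 - s * z.1) ^+ 2 / (b ^+ 2 *+ 2))); last first.
        by apply/funext => z; rewrite normal_pdfE.
      apply: measurable_funM => //; apply: measurableT_comp => //.
      apply: measurable_funM => //; apply: measurableT_comp => //.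
      apply: measurable_funX; apply: measurable_funB => //.
      exact: measurable_funM.
    by move=> z; rewrite lee_fin mulr_ge0// normal_pdf_ge0.
  apply: eq_integral => u _; rewrite normal_probE// -ge0_integralZr//.
  - by apply: eq_integral => x _; rewrite -EFinM; congr EFin; ring.
  - apply/measurable_EFinP/measurable_funM; first exact: measurable_indic.
    exact: measurable_normal_pdf.
  - by move=> x _; rewrite lee_fin mulr_ge0// normal_pdf_ge0.
  - by rewrite lee_fin normal_pdf_ge0.
etransitivity.
  apply: (@fubini_tonelli _ _ (measurableTypeR R) (measurableTypeR R) R mu mu
    (fun z : R * R =>
      (\1_B z.2 * (normal_pdf 0 a z.1 * normal_pdf (s * z.1) b z.2))%:E)).
    exact/measurable_EFinP.
  by move=> z; rewrite lee_fin !mulr_ge0// normal_pdf_ge0.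
rewrite normal_probE//; apply: eq_integral => x _ /=.
under eq_integral do rewrite (normal_pdfM _ _ a0 b0 c0 cE) mulrA EFinM.
rewrite ge0_integralZl//; last 3 first.
- by apply/measurable_EFinP; exact: measurable_normal_pdf.
- by move=> u _; rewrite lee_fin normal_pdf_ge0.
- by rewrite lee_fin mulr_ge0// normal_pdf_ge0.
by rewrite integral_normal_pdf mule1.
Qed.

(** Density of the centred normal law of deviation [s'] with respect to the one of deviation [s]. *)
Definition normal_tilt s s' x : R :=
  s / s' * expR (- (x ^+ 2 / 2 * (s' ^- 2 - s ^- 2))).

Lemma normal_tilt_ge0 s s' x : 0 < s -> 0 < s' -> 0 <= normal_tilt s s' x.
Proof. by move=> s0 s'0; rewrite mulr_ge0 ?expR_ge0// divr_ge0// ltW. Qed.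

Lemma measurable_normal_tilt s s' : measurable_fun [set: R] (normal_tilt s s').
Proof.
apply: measurable_funM => //; apply: measurableT_comp => //.
apply: measurableT_comp => //; apply: measurable_funM => //.
by apply: measurable_funM => //; exact: measurable_funX.
Qed.

Lemma normal_pdf_tilt s s' x : 0 < s -> 0 < s' ->
  normal_pdf 0 s' x = normal_tilt s s' x * normal_pdf 0 s x.
Proof.
move=> s0 s'0; rewrite !normal_pdfE ?gt_eqF// !normal_peakE// /normal_fun.
rewrite /normal_tilt [in RHS]mulrACA -expRD; congr (_ * expR _).
  by field; rewrite !gt_eqF// sqrtr_gt0 mulrn_wgt0// pi_gt0.
by rewrite !subr0; field; rewrite !gt_eqF.
Qed.

Lemma ge0_integral_normal_tilt s s' (f : R -> \bar R) : 0 < s -> 0 < s' ->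
  measurable_fun [set: R] f -> (forall x, 0 <= f x)%E ->
  (\int[normal_prob 0 s]_x (f x * (normal_tilt s s' x)%:E) =
   \int[normal_prob 0 s']_x f x)%E.
Proof.
move=> s0 s'0 mf f0; rewrite !ge0_integral_normal_prob//.
- apply: eq_integral => x _.
  by rewrite [in RHS](normal_pdf_tilt x s0 s'0) [in RHS]EFinM [in RHS]muleA.
- apply: emeasurable_funM => //; apply/measurable_EFinP.
  exact: measurable_normal_tilt.
- by move=> x; rewrite mule_ge0// lee_fin normal_tilt_ge0.
Qed.

End gaussian_laws.

(** * Second and fourth Gaussian moments, by differentiating Laplace transforms *)

Lemma exp_quotient_bounds (R : realType) (e y : R) : 0 < e -> 0 <= y ->
  y / (1 + e * y) <= (1 - expR (- (e * y))) / e <= y.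
Proof.
move=> e0 y0; have ey0 : 0 <= e * y by rewrite mulr_ge0// ltW.
have ey1 : 0 < 1 + e * y by rewrite ltr_wpDr.
apply/andP; split.
  (* Both bounds are [1 + x <= expR x], at [x = e * y] for the lower one and at [x = - (e * y)] for
     the upper one. *)
  rewrite ler_pdivlMr// mulrAC ler_pdivrMr// mulrC.
  rewrite mulrBl mul1r expRN.
  rewrite lerBrDr addrC -lerBrDr.
  by rewrite ler_pdivrMl ?expR_gt0// addrK mulr1 expR_ge1Dx.
rewrite ler_pdivrMr// [y * e]mulrC lerBlDl -lerBlDr.
by have := expR_ge1Dx (- (e * y)).
Qed.

(* [(1 - expR (- e y)) / e] is a difference quotient of [s |-> expR (- s y)] at
   [0]: this is differentiation of a Laplace transform under the integral. *)
Lemma ge0_integral_laplace_derivative d (T : measurableType d) (R : realType)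
    (mu : {measure set T -> \bar R}) (f y : T -> R) (e c : R^nat) (l : R) :
  measurable_fun [set: T] f -> measurable_fun [set: T] y ->
  (forall x, 0 <= f x) -> (forall x, 0 <= y x) -> (forall n, 0 < e n) ->
  e @ \oo --> 0 -> c @ \oo --> l ->
  (forall n, \int[mu]_x (f x * ((1 - expR (- (e n * y x))) / e n))%:E =
    (c n)%:E)%E ->
  (\int[mu]_x (f x * y x)%:E = l%:E)%E.
Proof.
move=> mf my f0 y0 e0 ecvg ccvg intc.
pose F n x := f x * ((1 - expR (- (e n * y x))) / e n).
have mF n : measurable_fun [set: T] (F n).
  apply: measurable_funM => //; apply: measurable_funM => //.
  apply: measurable_funB => //; apply: measurableT_comp => //.
  by apply: measurableT_comp => //; exact: measurable_funM.
have F0 n x : 0 <= F n x.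
  rewrite mulr_ge0//; have /andP[+ _] := exp_quotient_bounds (e0 n) (y0 x).
  by apply: le_trans; rewrite divr_ge0// addr_ge0// mulr_ge0// ltW.
have FE : (fun n => \int[mu]_x (F n x)%:E)%E @ \oo --> l%:E.
  have -> : (fun n => \int[mu]_x (F n x)%:E)%E = EFin \o c by exact/funext.
  by apply/fine_cvgP; split; [exact: nearW|].
have Fcvg x : (F n x)%:E @[n --> \oo] --> (f x * y x)%:E.
  apply/fine_cvgP; split; first exact: nearW.
  have lcvg : f x * (y x / (1 + e n * y x)) @[n --> \oo] --> f x * y x.
    have -> : f x * y x = f x * (y x / (1 + 0 * y x)).
      by rewrite mul0r addr0 divr1.
    apply: cvgM; first exact: cvg_cst.
    apply: cvgM; first exact: cvg_cst.
    apply: cvgV; first by rewrite mul0r addr0 oner_eq0.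
    by apply: cvgD; [exact: cvg_cst|apply: cvgM => //; exact: cvg_cst].
  apply: (squeeze_cvgr _ lcvg (cvg_cst _)).
  apply: nearW => n /=; have /andP[h1 h2] := exp_quotient_bounds (e0 n) (y0 x).
  by rewrite !ler_wpM2l.
(* [f * y] is not yet known to be integrable, so it cannot serve as a dominating function. Fatou
   gives one inequality, and [F n <= f * y] gives the other. *)
apply/eqP; rewrite eq_le; apply/andP; split.
  have := @fatou _ _ _ mu _ measurableT (fun n x => (F n x)%:E)
    (fun n => (measurable_EFinP _ _).2 (mF n)) (fun n x _ => F0 n x).
  rewrite (cvg_limn_einf_sup FE).1; apply: le_trans.
  rewrite le_eqVlt; apply/orP; left; apply/eqP; apply: eq_integral => x _.
  by rewrite (cvg_limn_einf_sup (Fcvg x)).1.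
rewrite -(cvg_lim _ FE)//; apply: lime_le; first by apply/cvg_ex; exists l%:E.
apply: nearW => n; apply: ge0_le_integral => //.
- by move=> x _; rewrite lee_fin F0.
- exact/measurable_EFinP.
- by apply/measurable_EFinP; exact: measurable_funM.
- move=> x _; rewrite lee_fin ler_wpM2l//.
  by have /andP[] := exp_quotient_bounds (e0 n) (y0 x).
Qed.

Section gaussian_moments.
Variable R : realType.

Let k (n : nat) : R := 1 + n.+1%:R^-1.

Let k_gt1 n : 1 < k n.
Proof. by rewrite /k ltrDl invr_gt0 ltr0n. Qed.

Let cvg_k : k @ \oo --> (1 : R).
Proof.
rewrite -[X in _ --> X]addr0; apply: cvgD; first exact: cvg_cst.
exact: cvg_harmonic.
Qed.

(** Chosen so that [expR (- (e s n * x ^+ 2))] equals [normal_tilt s (s / k n) x / k n]: this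
    Laplace factor amounts to dividing the deviation by [k n]. *)
Let e (s : R) n := (k n ^+ 2 - 1) / (2 * s ^+ 2).

(** [M] is the mean of [f] as a function of the deviation. Knowing it for all deviations yields the
    mean of [f x * x ^+ 2], so even moments are obtained two degrees at a time, starting from
    [f = 1]. *)
Lemma ge0_integral_normal_sqr (f M : R -> R) (s l : R) :
  measurable_fun [set: R] f -> (forall x, 0 <= f x) -> 0 < s ->
  (forall s' : R, 0 < s' ->
    (\int[normal_prob 0 s']_x (f x)%:E = (M s')%:E)%E) ->
  ((fun n => (M s - M (s / k n) / k n) / e s n) @ \oo --> l) ->
  (\int[normal_prob 0 s]_x (f x * x ^+ 2)%:E = l%:E)%E.
Proof.
move=> mf f0 s0 intf; have s20 : 0 < 2 * s ^+ 2 by rewrite mulr_gt0// exprn_gt0.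
have k_gt0 n : 0 < k n by exact: lt_trans ltr01 (k_gt1 n).
have e0 n : 0 < e s n.
  by rewrite divr_gt0// subr_gt0 expr_gt1// ltW.
move=> cl; apply: (@ge0_integral_laplace_derivative _ (measurableTypeR R) R
  (normal_prob 0 s) f (fun x => x ^+ 2) (e s) _ l _ _ f0 _ e0 _ cl) => //.
- by move=> x; rewrite sqr_ge0.
- rewrite (_ : 0 = (1 ^+ 2 - 1) / (2 * s ^+ 2)); last by rewrite expr1n subrr mul0r.
  apply: cvgM; last exact: cvg_cst.
  by apply: cvgB; [exact: cvgM|exact: cvg_cst].
move=> n; pose g x := f x * expR (- (e s n * x ^+ 2)).
have mg : measurable_fun [set: R] g.
  apply: measurable_funM => //; apply: measurableT_comp => //.
  by apply: measurableT_comp => //; exact: measurable_funM.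
have g0 x : 0 <= g x by rewrite mulr_ge0// expR_ge0.
have intg : (\int[normal_prob 0 s]_x (g x)%:E = (M (s / k n) / k n)%:E)%E.
  transitivity (\int[normal_prob 0 s]_x
     ((k n)^-1%:E * ((f x)%:E * (normal_tilt s (s / k n) x)%:E)))%E.
    apply: eq_integral => x _; rewrite -!EFinM; congr EFin.
    rewrite /g /normal_tilt [RHS]mulrCA; congr (_ * _).
    have kE : (k n)^-1 * (s / (s / k n)) = 1 by field; rewrite !gt_eqF.
    rewrite [RHS]mulrA kE mul1r.
    congr (expR (- _)); rewrite /e; field; by rewrite !gt_eqF.
  rewrite ge0_integralZl//; last 3 first.
  - apply: emeasurable_funM; apply/measurable_EFinP => //.
    exact: measurable_normal_tilt.
  - move=> x _; rewrite mule_ge0// lee_fin ?normal_tilt_ge0//.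
    by rewrite divr_gt0.
  - by rewrite lee_fin invr_ge0 ltW.
  rewrite ge0_integral_normal_tilt ?divr_gt0//.
  + by rewrite intf ?divr_gt0// -EFinM mulrC.
  exact/measurable_EFinP.
have intf_ : (normal_prob 0 s).-integrable setT (EFin \o f).
  exact: (@ge0_integral_fin_integrable _ (measurableTypeR R) R _ _ _ mf f0 (intf _ s0)).
have intg_ : (normal_prob 0 s).-integrable setT (EFin \o g).
  exact: (@ge0_integral_fin_integrable _ (measurableTypeR R) R _ _ _ mg g0 intg).
transitivity (\int[normal_prob 0 s]_x ((e s n)^-1%:E * ((f x)%:E - (g x)%:E)))%E.
  apply: eq_integral => x _; rewrite -EFinB -EFinM; congr EFin; rewrite /g; ring.
rewrite integralZl//; last first.
  exact: integrableB.
rewrite integralB//.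
by rewrite intf// intg -EFinB -EFinM mulrC.
Qed.

Lemma normal_second_moment (s : R) : 0 < s ->
  (\int[normal_prob 0 s]_x (x ^+ 2)%:E = (s ^+ 2)%:E)%E.
Proof.
move=> s0; under eq_integral do rewrite -[_ ^+ 2]mul1r.
apply: (@ge0_integral_normal_sqr (cst 1) (cst 1)) => //.
  move=> s' _; etransitivity.
    exact: (@integral_cst _ (measurableTypeR R) R (normal_prob 0 s') _
      measurableT 1%E).
  rewrite mul1e; exact: (@probability_setT _ _ _ (normal_prob 0 s')).
(* The factor [k n - 1] cancels, leaving a quotient that is continuous at [k = 1]. *)
rewrite (_ : (fun _ => _) = fun n => 2 * s ^+ 2 / (k n * (k n + 1))); last first.
  apply/funext => n /=; have k1 := k_gt1 n; rewrite /e.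
  have -> : k n ^+ 2 - 1 = (k n - 1) * (k n + 1) by ring.
  have k0 : 0 < k n by exact: lt_trans k1.
  have kp : 0 < k n + 1 by lra.
  have km : 0 < k n - 1 by lra.
  by field; rewrite !gt_eqF.
rewrite [X in _ --> X](_ : _ = 2 * s ^+ 2 / (1 * (1 + 1))); last by field.
apply: cvgM; first exact: cvg_cst.
apply: cvgV; first by rewrite mul1r; lra.
by apply: cvgM => //; apply: cvgD => //; exact: cvg_cst.
Qed.

Lemma normal_fourth_moment (s : R) : 0 < s ->
  (\int[normal_prob 0 s]_x (x ^+ 4)%:E = (3 * s ^+ 4)%:E)%E.
Proof.
move=> s0; under eq_integral do rewrite (exprD _ 2 2).
apply: (@ge0_integral_normal_sqr (fun x => x ^+ 2) (fun s => s ^+ 2)) => //.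
- by move=> x; rewrite sqr_ge0.
- by move=> s'; exact: normal_second_moment.
rewrite (_ : (fun _ => _) = fun n =>
  2 * s ^+ 4 * (k n * k n + k n + 1) / (k n * k n * k n * (k n + 1))); last first.
  apply/funext => n /=; have k1 := k_gt1 n; rewrite /e.
  have -> : k n ^+ 2 - 1 = (k n - 1) * (k n + 1) by ring.
  have k0 : 0 < k n by exact: lt_trans k1.
  have kp : 0 < k n + 1 by lra.
  have km : 0 < k n - 1 by lra.
  by field; rewrite !gt_eqF.
rewrite [X in _ --> X](_ : _ = 2 * s ^+ 4 * (1 * 1 + 1 + 1) / (1 * 1 * 1 * (1 + 1)));
  last by field.
apply: cvgM; last first.
  apply: cvgV; first by rewrite !mul1r; lra.
  by repeat apply: cvgM => //; apply: cvgD => //; exact: cvg_cst.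
apply: cvgM; first exact: cvg_cst.
by repeat apply: cvgD; [exact: cvgM| |exact: cvg_cst].
Qed.

End gaussian_moments.

(** * Signed measures with vanishing moments *)

(** With [r = s ^+ 2], one factor [s ^+ n] keeps [n%:R * s ^+ n] below [(1 - s)^-1] and the other
    tends to 0. *)
Lemma cvg_natM_geometric (R : realType) (r : R) : 0 <= r -> r < 1 ->
  (n%:R * r ^+ n) @[n --> \oo] --> 0.
Proof.
move=> r0 r1; pose s := Num.sqrt r.
have s0 : 0 <= s by exact: sqrtr_ge0.
have s1 : s < 1 by rewrite -sqrtr1 ltr_sqrt.
have ss : r = s ^+ 2 by rewrite sqr_sqrtr.
have bnd n : n%:R * s ^+ n <= (1 - s)^-1.
  rewrite -[leRHS]mul1r ler_pdivlMr ?subr_gt0//.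
  elim: n => [|n IH]; first by rewrite !mul0r.
  have -> : n.+1%:R * s ^+ n.+1 * (1 - s) =
      s * (n%:R * s ^+ n * (1 - s)) + s * s ^+ n * (1 - s).
    by rewrite exprS -natr1; ring.
  have : s * (n%:R * s ^+ n * (1 - s)) <= s * 1 by rewrite ler_wpM2l.
  have : s * s ^+ n * (1 - s) <= 1 * (1 - s).
    apply: ler_wpM2r; first by rewrite subr_ge0 ltW.
    by rewrite -exprS exprn_ile1// ltW.
  lra.
have lim0 : ((1 - s)^-1 * s ^+ n) @[n --> \oo] --> 0.
  rewrite -[X in _ --> X](mulr0 (1 - s)^-1); apply: cvgM; first exact: cvg_cst.
  by apply: cvg_expr; rewrite ger0_norm.
apply: (squeeze_cvgr _ (cvg_cst 0) lim0).
apply: nearW => n; rewrite mulr_ge0 ?exprn_ge0//=.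
by rewrite ss -exprM mulnC exprM expr2 mulrA ler_wpM2r// exprn_ge0.
Qed.

Section threshold_polynomial.
Variable R : realType.
Implicit Types c z : R.

(** The exponent is of order [n * c ^- n]. Multiplied by [z ^+ n] it tends to 0 for [z < c] and is
    at least [n] for [z >= c], so [(1 - z ^+ n) ^+ mult c n] approximates the indicator of [z < c]
    on the unit interval. *)
Let mult c n := (n * (Num.truncn (c ^- n)).+1)%N.

Definition threshold_poly c n : {poly R} := (1 - 'X^n) ^+ mult c n.

Lemma threshold_polyE c n z :
  (threshold_poly c n).[z] = (1 - z ^+ n) ^+ mult c n.
Proof. by rewrite /threshold_poly !hornerE. Qed.

Lemma threshold_poly_itv c n z : 0 <= z <= 1 ->
  0 <= (threshold_poly c n).[z] <= 1.
Proof.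
move=> /andP[z0 z1]; rewrite threshold_polyE.
have h0 : 0 <= 1 - z ^+ n by rewrite subr_ge0 exprn_ile1.
by rewrite exprn_ge0//= exprn_ile1// lerBlDr lerDl exprn_ge0.
Qed.

Lemma bernoulli_ineq (x : R) n : 0 <= x <= 1 -> 1 - n%:R * x <= (1 - x) ^+ n.
Proof.
move=> /andP[x0 x1]; elim: n => [|n IH]; first by rewrite mul0r subr0 expr0.
rewrite exprS -natr1.
have h : (1 - x) * (1 - n%:R * x) <= (1 - x) * (1 - x) ^+ n.
  by rewrite ler_wpM2l// subr_ge0.
apply: le_trans h; have : 0 <= n%:R * x * x by rewrite !mulr_ge0.
lra.
Qed.

Lemma bernoulli_inv_ineq (x : R) n : 0 <= x <= 1 ->
  (1 - x) ^+ n <= (1 + n%:R * x)^-1.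
Proof.
move=> /andP[x0 x1].
have h : 1 + n%:R * x <= (1 + x) ^+ n.
  elim: n => [|n IH]; first by rewrite mul0r addr0 expr0.
  rewrite exprS -natr1.
  have : (1 + x) * (1 + n%:R * x) <= (1 + x) * (1 + x) ^+ n.
    by rewrite ler_wpM2l// addr_ge0.
  apply: le_trans; have : 0 <= n%:R * x * x by rewrite !mulr_ge0.
  lra.
have p0 : 0 < 1 + n%:R * x by rewrite ltr_wpDr// mulr_ge0.
rewrite -[leRHS]mul1r ler_pdivlMr//.
apply: (@le_trans _ _ ((1 - x) ^+ n * (1 + x) ^+ n)).
  by rewrite ler_wpM2l// exprn_ge0// subr_ge0.
rewrite -exprMn exprn_ile1//.
  by rewrite mulr_ge0 ?subr_ge0 ?addr_ge0.
by have : 0 <= x * x by [rewrite mulr_ge0|]; lra.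
Qed.

(** Below [c], Bernoulli's inequality pushes the values up to 1; from [c] on, its reciprocal form
    bounds them by [1 / (n + 1)]. *)
Lemma cvg_threshold_poly c z : 0 < c <= 1 -> 0 <= z <= 1 ->
  (threshold_poly c n).[z] @[n --> \oo] --> (\1_[set x | x < c] z : R).
Proof.
move=> /andP[c0 c1] z01; have /andP[z0 z1] := z01.
have zn01 n : 0 <= z ^+ n <= 1 by rewrite exprn_ge0//= exprn_ile1.
have cn1 n : 1 <= c ^- n.
  by rewrite invf_ge1 ?exprn_gt0// exprn_ile1// ltW.
rewrite indicE; case: (ltP z c) => zc.
  rewrite mem_set//=.
  (* The factor 2 absorbs the rounding: the truncation of [c ^- n] plus one is at most [2 * c ^- n],
     since [c ^- n >= 1]. *)
  have lim1 : (1 - 2 * (n%:R * (z / c) ^+ n)) @[n --> \oo] --> (1 : R).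
    rewrite -[X in _ --> X]subr0; apply: cvgB; first exact: cvg_cst.
    rewrite -[X in _ --> X](mulr0 2); apply: cvgM; first exact: cvg_cst.
    apply: cvg_natM_geometric; first by rewrite divr_ge0// ltW.
    by rewrite ltr_pdivrMr// mul1r.
  have lim1' : (fun _ : nat => 1 : R) @ \oo --> (1 : R) by exact: cvg_cst.
  apply: (squeeze_cvgr _ lim1 lim1').
  apply: nearW => n; have /andP[_ ->] := threshold_poly_itv c n z01.
  rewrite andbT threshold_polyE; apply: le_trans (bernoulli_ineq _ (zn01 n)).
  rewrite lerD2l lerN2 /mult natrM -mulrA [leRHS]mulrCA.
  rewrite ler_wpM2l// expr_div_n mulrA [leRHS]mulrAC ler_wpM2r ?exprn_ge0//.
  have trc : (Num.truncn (c ^- n))%:R <= c ^- n.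
    by rewrite truncn_le (le_trans ler01 (cn1 n)).
  rewrite -natr1; have := cn1 n; lra.
rewrite memNset/=; last by apply/negP; rewrite -leNgt.
apply: (squeeze_cvgr _ (cvg_cst 0) cvg_harmonic).
apply: nearW => n; have /andP[-> _]/= := threshold_poly_itv c n z01.
rewrite threshold_polyE; apply: le_trans (bernoulli_inv_ineq _ (zn01 n)) _.
rewrite lef_pV2 ?posrE ?ltr0Sn//; last first.
  by rewrite ltr_wpDr// mulr_ge0//; case/andP: (zn01 n).
rewrite -natr1 addrC lerD2l /mult natrM -mulrA ler_peMr//.
apply: (@le_trans _ _ (c ^- n * z ^+ n)).
  rewrite mulrC ler_pdivlMr ?exprn_gt0// mul1r.
  by rewrite lerXn2r ?nnegrE// ltW.
rewrite ler_wpM2r ?exprn_ge0//; exact/ltW/truncnS_gt.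
Qed.

End threshold_polynomial.

Section vanishing_charge.
Context d (T : measurableType d) (R : realType).
Variables (mu : {measure set T -> \bar R}).
Implicit Types F : T -> R.
Local Open Scope ereal_scope.

(** Turns the vanishing of a signed integral into equality of two positive measures, to which
    uniqueness on a pi-system applies. *)
Lemma integral_eq0_funrposneg F (A : set T) : measurable A ->
  mu.-integrable setT (EFin \o F) ->
  \int[mu]_(x in A) (F x)%:E = 0 <->
  \int[mu]_(x in A) (F^\+%R x)%:E = \int[mu]_(x in A) (F^\-%R x)%:E.
Proof.
move=> mA intF; have intFA := integrableS measurableT mA (@subsetT _ _) intF.
have fp : \int[mu]_(x in A) (F^\+%R x)%:E \is a fin_num.
  apply: (@integrable_fin_num _ _ _ mu A mA (EFin \o F^\+%R)).
  by rewrite -funerpos; exact: integrable_funepos.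
have fn : \int[mu]_(x in A) (F^\-%R x)%:E \is a fin_num.
  apply: (@integrable_fin_num _ _ _ mu A mA (EFin \o F^\-%R)).
  by rewrite -funerneg; exact: integrable_funeneg.
have -> : \int[mu]_(x in A) (F x)%:E =
    \int[mu]_(x in A) (F^\+%R x)%:E - \int[mu]_(x in A) (F^\-%R x)%:E.
  by have := integralE mu A (EFin \o F); rewrite funerpos funerneg.
split=> [|->]; last by rewrite subee.
by rewrite -(fineK fp) -(fineK fn) -EFinB => -[/eqP]; rewrite subr_eq0 => /eqP ->.
Qed.

Lemma integral_eq0_generator d' (S : measurableType d') (G : set (set S))
    (g : (set S)^nat) F (Z : T -> S) :
  measurable_fun setT Z -> measurable = <<s G >> -> setI_closed G ->
  (forall n, G (g n)) -> \bigcup_n g n = setT ->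
  mu.-integrable setT (EFin \o F) ->
  (forall B, G B -> \int[mu]_(x in Z @^-1` B) (F x)%:E = 0) ->
  forall B, measurable B -> \int[mu]_(x in Z @^-1` B) (F x)%:E = 0.
Proof.
move=> mZ mG GI Gg gT intF FG.
have mF : measurable_fun setT F by apply/measurable_EFinP; exact: measurable_int intF.
have mFp : measurable_fun setT (F^\+)%R by exact: measurable_funrpos.
have mFn : measurable_fun setT (F^\-)%R by exact: measurable_funrneg.
have mZB B : measurable B -> measurable (Z @^-1` B).
  by move=> mB; rewrite -[X in measurable X]setTI; exact: mZ.
have Gm B : G B -> measurable B by rewrite mG; exact: sub_sigma_algebra.
pose m1 := mpushforward (mdensity mu mFp (@funrpos_ge0 _ _ F)) mZ.
pose m2 := mpushforward (mdensity mu mFn (@funrneg_ge0 _ _ F)) mZ.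
move=> B mB; apply/integral_eq0_funrposneg; [exact: mZB|by []|].
rewrite -[LHS]/(m1 B) -[RHS]/(m2 B).
apply: (@measure_unique _ _ _ G g mG GI Gg gT m1 m2) => //.
- move=> A GA; apply/integral_eq0_funrposneg => //; last exact: FG.
  exact/mZB/Gm.
- move=> n; rewrite -[X in X < _]/(\int[mu]_(x in Z @^-1` g n) (EFin \o F^\+%R) x).
  rewrite -ge0_fin_numE; last by apply: integral_ge0 => x _; rewrite lee_fin funrpos_ge0.
  have mgn := mZB _ (Gm _ (Gg n)).
  apply: integrable_fin_num => //; rewrite -funerpos; apply: integrable_funepos => //.
  exact: integrableS intF.
Qed.

Lemma integrable_mul_le1 F (h : T -> R) : measurable_fun setT h ->
  (forall x, `|h x| <= 1)%R -> mu.-integrable setT (EFin \o F) ->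
  mu.-integrable setT (fun x => (F x * h x)%:E).
Proof.
move=> mh h1 intF; apply: (le_integrable measurableT _ _ intF).
  apply/measurable_EFinP/measurable_funM => //.
  by apply/measurable_EFinP; exact: measurable_int intF.
move=> x _ /=; rewrite lee_fin normrM ler_piMr//.
Qed.

(** Every polynomial in [Z] integrates to 0 against [F]. The threshold polynomials are bounded by 1
    and converge pointwise to the indicator of [Z < c], so dominated convergence gives 0 on rays,
    which generate the Borel sets. *)
Lemma vanishing_moments F (Z : T -> R) : measurable_fun setT Z ->
  (forall x, 0 <= Z x <= 1)%R -> mu.-integrable setT (EFin \o F) ->
  (forall n, \int[mu]_x (F x * Z x ^+ n)%:E = 0) ->
  forall B, measurable B -> \int[mu]_(x in Z @^-1` B) (F x)%:E = 0.
Proof.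
move=> mZ Z01 intF FZ.
have mF : measurable_fun setT F by apply/measurable_EFinP; exact: measurable_int intF.
have Z1 x : (`|Z x| <= 1)%R by rewrite ger0_norm; case/andP: (Z01 x).
have polyE (p : {poly R}) : \int[mu]_x (F x * p.[Z x])%:E = 0.
  under eq_integral do rewrite horner_coef mulr_sumr -sumEFin.
  have intc n : mu.-integrable setT (fun x => (F x * Z x ^+ n)%:E).
    apply: integrable_mul_le1 => //; first exact: measurable_funX.
    by move=> x; rewrite normrX exprn_ile1.
  rewrite integral_sum//; last first.
    move=> i; under eq_fun do rewrite mulrCA EFinM; exact: integrableZl.
  rewrite big1// => i _; under eq_integral do rewrite mulrCA EFinM.
  by rewrite integralZl// FZ mule0.
have rayE c : \int[mu]_(x in Z @^-1` `]-oo, c[%classic) (F x)%:E = 0.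
  have -> : \int[mu]_(x in Z @^-1` `]-oo, c[%classic) (F x)%:E =
      \int[mu]_x (F x * \1_[set x | x < c]%R (Z x))%:E.
    rewrite integral_mkcond; apply: eq_integral => x _.
    rewrite patchE indicE; have [xc|xc] := pselect (Z x < c)%R.
      by rewrite !mem_set ?mulr1//= in_itv/=.
    by rewrite !memNset ?mulr0//= in_itv/=.
  (* Outside []0, 1]] the ray contains no value of [Z], or all of them; the latter is the moment of
     order 0. *)
  have [c0|c0] := leP c 0%R.
    under eq_integral => x _.
      rewrite indicE memNset/=; last first.
        by apply/negP; rewrite -leNgt (le_trans c0)//; case/andP: (Z01 x).
      rewrite mulr0; over.
    by rewrite integral0.
  have [c1|c1] := leP c 1%R; last first.
    under eq_integral => x _.
      rewrite indicE mem_set/=; last first.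
        by rewrite (le_lt_trans _ c1)//; case/andP: (Z01 x).
      rewrite -[1%R](expr0 (Z x)); over.
    exact: FZ.
  have cc : (0 < c <= 1)%R by rewrite c0 c1.
  have mthr n : measurable_fun setT (fun x => (threshold_poly c n).[Z x]).
    under eq_fun do rewrite threshold_polyE.
    by apply: measurable_funX; apply: measurable_funB => //; exact: measurable_funX.
  have mind : measurable_fun setT (fun x => \1_[set x | x < c]%R (Z x) : R).
    apply: (measurableT_comp _ mZ); apply: measurable_indic.
    rewrite (_ : mkset _ = `]-oo, c[%classic); first exact: measurable_itv.
    by apply/seteqP; split => y /=; rewrite in_itv.
  have h1 n : measurable_fun setT (fun x => (F x * (threshold_poly c n).[Z x])%:E).
    by apply/measurable_EFinP; exact: measurable_funM.
  have h2 : measurable_fun setT (fun x => (F x * \1_[set x | x < c]%R (Z x))%:E).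
    by apply/measurable_EFinP; exact: measurable_funM.
  have h3 : {ae mu, forall x, setT x ->
      (F x * (threshold_poly c n).[Z x])%:E @[n --> \oo] -->
      (F x * \1_[set x | x < c]%R (Z x))%:E}.
    apply: aeW => x _; apply/fine_cvgP; split; first exact: nearW.
    apply: cvgM; first exact: cvg_cst.
    exact: cvg_threshold_poly.
  have h5 : {ae mu, forall x n, setT x ->
      `|(F x * (threshold_poly c n).[Z x])%:E| <= `|(F x)%:E|}.
    apply: aeW => x n _; rewrite lee_fin normrM ler_piMr//.
    by have /andP[h0 h'1] := threshold_poly_itv c n (Z01 x); rewrite ger0_norm.
  have [_ _] := dominated_convergence measurableT h1 h2 h3 (integrable_abse intF) h5.
  rewrite (_ : [sequence _]_n = cst 0); last first.
    by apply/funext => n; exact: polyE.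
  by move=> H; rewrite -(cvg_lim (@ereal_hausdorff R) H) lim_cst.
have Gcover : \bigcup_n `]-oo, n%:R[%classic = [set: R].
  rewrite -subTset => x _; exists (Num.truncn x).+1 => //=.
  by rewrite in_itv/= truncnS_gt.
apply: (integral_eq0_generator mZ (RGenInftyO.measurableE R) _ _ Gcover intF).
- move=> _ _ [a ->] [b ->]; exists (Num.min a b).
  apply/seteqP; split => y /=; rewrite !in_itv/= lt_min.
    by case=> -> ->.
  by move/andP.
- by move=> n; exists n%:R.
- by move=> _ [c ->].
Qed.

Lemma vanishing_moments2 F (Z1 Z2 : T -> R) :
  measurable_fun setT Z1 -> measurable_fun setT Z2 ->
  (forall x, 0 <= Z1 x <= 1)%R -> (forall x, 0 <= Z2 x <= 1)%R ->
  mu.-integrable setT (EFin \o F) ->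
  (forall m n, \int[mu]_x (F x * Z1 x ^+ m * Z2 x ^+ n)%:E = 0) ->
  forall B, measurable B ->
    \int[mu]_(x in (fun x => (Z1 x, Z2 x)) @^-1` B) (F x)%:E = 0.
Proof.
move=> mZ1 mZ2 Z101 Z201 intF FZ.
pose G : set (set (R * R)) := [set A `*` B | A in measurable & B in measurable].
apply: (@integral_eq0_generator _ _ G (fun=> setT)) => //.
- exact: measurable_fun_pair.
- exact: measurable_prod_measurableType.
- move=> _ _ [A1 mA1 [B1 mB1 <-]] [A2 mA2 [B2 mB2 <-]].
  exists (A1 `&` A2); first exact: measurableI.
  by exists (B1 `&` B2); [exact: measurableI|rewrite setXI].
- by move=> _; exists setT => //; exists setT => //; rewrite setXTT.
- by rewrite bigcup_const//; exists 0%N.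
move=> _ [A mA [B mB <-]].
have mZA : measurable (Z1 @^-1` A).
  by rewrite -[X in measurable X]setTI; exact: mZ1.
have -> : \int[mu]_(x in (fun x => (Z1 x, Z2 x)) @^-1` (A `*` B)) (F x)%:E =
    \int[mu]_(x in Z2 @^-1` B) (F x * \1_(Z1 @^-1` A) x)%:E.
  rewrite (_ : _ @^-1` (A `*` B) = Z2 @^-1` B `&` Z1 @^-1` A); last first.
    by apply/seteqP; split => x [].
  rewrite integral_mkcondr; apply: eq_integral => x _.
  by rewrite patchE indicE; case: ifP => _; rewrite ?mulr1 ?mulr0.
have ind1 x : (`|\1_(Z1 @^-1` A) x : R| <= 1)%R.
  by rewrite indicE; case: (_ \in _); rewrite ?normr1 ?normr0.
have Zn1 (Z : T -> R) n : (forall x, 0 <= Z x <= 1)%R -> forall x, (`|Z x ^+ n| <= 1)%R.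
  move=> Z01 x; have /andP[z0 z1] := Z01 x.
  by rewrite normrX exprn_ile1// ger0_norm.
apply: vanishing_moments => //; first exact: integrable_mul_le1.
move=> n; have -> : \int[mu]_x (F x * \1_(Z1 @^-1` A) x * Z2 x ^+ n)%:E =
    \int[mu]_(x in Z1 @^-1` A) (F x * Z2 x ^+ n)%:E.
  rewrite [RHS]integral_mkcond; apply: eq_integral => x _.
  rewrite patchE indicE; case: ifP => _; rewrite ?mulr1 ?mulr0 ?mul0r//.
apply: (@vanishing_moments (fun x => F x * Z2 x ^+ n)%R) => //.
  by apply: integrable_mul_le1 => //; [exact: measurable_funX|exact: Zn1].
move=> m; rewrite -[RHS](FZ m n); apply: eq_integral => x _; congr EFin; ring.
Qed.

End vanishing_charge.

(** * Calculus of finite means *)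

Section mean_value.
Context d (T : measurableType d) (R : realType) (mu : probability T R).
Implicit Types (f g : T -> R) (a b : R).

(** Integrability travels with a real value, so linear combinations are computed in [R] and never
    meet an undefined difference of infinities. *)
Definition has_mean f a :=
  mu.-integrable [set: T] (EFin \o f) /\ (\int[mu]_w (f w)%:E = a%:E)%E.

Lemma has_mean_cst a : has_mean (fun=> a) a.
Proof.
split; first exact: finite_measure_integrable_cst.
rewrite (integral_cst mu measurableT a%:E) [X in (_ * X)%E](_ : _ = 1%E) ?mule1//.
exact: probability_setT.
Qed.

Lemma has_meanZ k f a : has_mean f a -> has_mean (fun w => k * f w) (k * a).
Proof.
move=> [intf fa]; split.
  exact: (@integrableZl _ _ _ mu _ measurableT k (EFin \o f) intf).
under eq_integral do rewrite EFinM.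
by rewrite integralZl// fa.
Qed.

Lemma has_meanD f g a b : has_mean f a -> has_mean g b ->
  has_mean (fun w => f w + g w) (a + b).
Proof.
move=> [intf fa] [intg gb]; split.
  exact: (@integrableD _ _ _ mu _ measurableT (EFin \o f) (EFin \o g)).
under eq_integral do rewrite EFinD.
by rewrite integralD// fa gb.
Qed.

Lemma has_meanB f g a b : has_mean f a -> has_mean g b ->
  has_mean (fun w => f w - g w) (a - b).
Proof.
move=> fa gb; have := has_meanD fa (has_meanZ (-1) gb).
rewrite mulN1r; congr has_mean; apply/funext => w; by rewrite mulN1r.
Qed.

Lemma has_mean_sum (I : Type) (s : seq I) (F : I -> T -> R) (a : I -> R) :
  (forall i, has_mean (F i) (a i)) ->
  has_mean (fun w => \sum_(i <- s) F i w) (\sum_(i <- s) a i).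
Proof.
move=> Fa; elim: s => [|i s IH].
  rewrite big_nil (_ : (fun _ => _) = fun=> 0); first exact: has_mean_cst.
  by apply/funext => w; rewrite big_nil.
rewrite big_cons (_ : (fun _ => _) = fun w => F i w + \sum_(j <- s) F j w).
  exact: has_meanD.
by apply/funext => w; rewrite big_cons.
Qed.

Lemma has_mean_integrable f : mu.-integrable [set: T] (EFin \o f) ->
  has_mean f (fine (\int[mu]_w (f w)%:E)).
Proof. by move=> intf; split => //; rewrite fineK//; exact: integrable_fin_num. Qed.

Lemma has_mean_measurable f a : has_mean f a -> measurable_fun [set: T] f.
Proof. by move=> [intf _]; apply/measurable_EFinP; exact: measurable_int intf. Qed.

Lemma has_mean_ge0 f a : measurable_fun [set: T] f -> (forall w, 0 <= f w) ->
  (\int[mu]_w (f w)%:E = a%:E)%E -> has_mean f a.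
Proof.
by move=> mf f0 fa; split=> //; exact: ge0_integral_fin_integrable fa.
Qed.

Lemma has_mean_le f g a : measurable_fun [set: T] f ->
  (forall w, `|f w| <= g w) -> has_mean g a -> exists b, has_mean f b.
Proof.
move=> mf fg [intg _]; eexists; apply: has_mean_integrable.
apply: (le_integrable measurableT _ _ intg); first exact/measurable_EFinP.
by move=> w _ /=; rewrite lee_fin (le_trans (fg w))// ler_norm.
Qed.

Lemma has_mean_expectation f a : has_mean f a -> ('E_mu[f] = a%:E)%E.
Proof. by move=> [_ <-]; rewrite unlock. Qed.

Lemma has_mean_indic f a (G : set T) : measurable G -> mu (~` G) = 0%E ->
  has_mean f a -> has_mean (fun w => \1_G w * f w) a.
Proof.
move=> mG G0 fa; have mf := has_mean_measurable fa.
have mGf : measurable_fun [set: T] (fun w => \1_G w * f w).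
  by apply: measurable_funM => //; exact: measurable_indic.
have aeE : ae_eq mu setT (fun w => (f w)%:E) (fun w => (\1_G w * f w)%:E).
  exists (~` G); split => //; first exact: measurableC.
  move=> w /=; apply: contra_notP => /contrapT Gw _.
  by rewrite indicE mem_set// mul1r.
split; last first.
  by rewrite -fa.2; apply/esym; apply: ae_eq_integral => //; exact/measurable_EFinP.
apply: (le_integrable measurableT _ _ fa.1); first exact/measurable_EFinP.
move=> w _ /=; rewrite lee_fin indicE; case: (_ \in _); first by rewrite mul1r.
by rewrite mul0r normr0.
Qed.

(** The measures with densities [D^+] and [D^-] have the same image under [Y], hence give the same
    integral to [u^+] and to [u^-]. The function [u] may be unbounded: integrability of the product
    [D * u(Y)] makes all four integrals finite. *)
Lemma has_mean_charge_orthogonal d' (S : measurableType d') (Y : T -> S) (D : T -> R)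
    (u : S -> R) a b :
  measurable_fun [set: T] Y -> measurable_fun [set: S] u -> has_mean D a ->
  (forall B, measurable B -> (\int[mu]_(w in Y @^-1` B) (D w)%:E = 0)%E) ->
  has_mean (fun w => D w * u (Y w)) b -> has_mean (fun w => D w * u (Y w)) 0.
Proof.
move=> mY mu_ Da D0 Dub; have mD := has_mean_measurable Da.
have mDp : measurable_fun setT (D^\+) by exact: measurable_funrpos.
have mDn : measurable_fun setT (D^\-) by exact: measurable_funrneg.
have Dp0 := @funrpos_ge0 _ _ D; have Dn0 := @funrneg_ge0 _ _ D.
have balance (v : S -> R) : measurable_fun [set: S] v -> (forall y, 0 <= v y) ->
    (forall y, v y <= `|u y|) ->
    exists c, has_mean (fun w => D^\+ w * v (Y w)) c /\
              has_mean (fun w => D^\- w * v (Y w)) c.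
  move=> mv v0 vu.
  have mvY : measurable_fun setT (v \o Y) by exact: measurableT_comp.
  have bnd (E : T -> R) : (forall w, 0 <= E w) -> (forall w, E w <= `|D w|) ->
      forall w, `|E w * v (Y w)| <= `|D w * u (Y w)|.
    move=> E0 ED w; rewrite ger0_norm ?mulr_ge0// normrM.
    by apply: ler_pM => //; exact: vu.
  have [c1 h1] : exists c1, has_mean (fun w => D^\+ w * v (Y w)) c1.
    apply: (@has_mean_le _ (fun w => `|D w * u (Y w)|)
      (fine (\int[mu]_w (`|D w * u (Y w)|)%:E))).
    - exact: measurable_funM.
    - apply: bnd => // w; rewrite /funrpos ge_max normr_ge0 andbT; exact: ler_norm.
    - by apply: has_mean_integrable; exact: (integrable_norm Dub.1).
  exists c1; split => //; apply: has_mean_ge0.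
  - exact: measurable_funM.
  - by move=> w; rewrite mulr_ge0.
  rewrite -h1.2.
  transitivity (\int[mdensity mu mDn Dn0]_w (v (Y w))%:E)%E.
    rewrite (ge0_integral_mdensity mu mDn Dn0 (f := fun w => (v (Y w))%:E)).
    - by apply: eq_integral => w _; rewrite -EFinM mulrC.
    - exact/measurable_EFinP.
    - by move=> w; rewrite lee_fin.
  transitivity (\int[mdensity mu mDp Dp0]_w (v (Y w))%:E)%E; last first.
    rewrite (ge0_integral_mdensity mu mDp Dp0 (f := fun w => (v (Y w))%:E)).
    - by apply: eq_integral => w _; rewrite -EFinM mulrC.
    - exact/measurable_EFinP.
    - by move=> w; rewrite lee_fin.
  apply: (@eq_ge0_integral_comp _ _ T S R (mdensity mu mDn Dn0)
    (mdensity mu mDp Dp0) Y (EFin \o v) mY) => [B mB||y].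
  - apply/esym/integral_eq0_funrposneg; last exact: D0.
      by rewrite -[X in measurable X]setTI; exact: mY.
    exact: Da.1.
  - exact/measurable_EFinP.
  - by rewrite lee_fin.
have [c1 [p1 n1]] := balance (u^\+) (measurable_funrpos mu_) (@funrpos_ge0 _ _ u)
  (fun y => ltac:(by rewrite /funrpos ge_max normr_ge0 andbT ler_norm)).
have [c2 [p2 n2]] := balance (u^\-) (measurable_funrneg mu_) (@funrneg_ge0 _ _ u)
  (fun y => ltac:(by rewrite /funrneg ge_max normr_ge0 andbT -normrN ler_norm)).
have := has_meanB (has_meanB p1 n1) (has_meanB p2 n2).
rewrite !subrr; congr has_mean; apply/funext => w.
rewrite -!mulrBl -mulrBr.
have posneg (x : R) : Num.max x 0 - Num.max (- x) 0 = x.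
  by case: (leP x 0) => hx; case: (leP (- x) 0) => hx'; lra.
by congr (_ * _); exact: posneg.
Qed.

End mean_value.

(** * Conditional probability of an event given a statistic *)

Section conditional_probability.
Context d d' (T : measurableType d) (S : measurableType d') (R : realType).
Variables (P : probability T R) (Y : T -> S) (A : set T).
Hypotheses (mY : measurable_fun [set: T] Y) (mA : measurable A).

Let law := mpushforward P mY.
Let joint := mpushforward (mrestr P mA) mY.

Let law_fin : fin_num_fun law.
Proof.
move=> B mB; rewrite /law mpushforwardE fin_num_measure//.
by rewrite -[X in measurable X]setTI; exact: mY.
Qed.

Let joint_fin : fin_num_fun joint.
Proof.
move=> B mB; rewrite /joint mpushforwardE /= /mrestr fin_num_measure//.
by apply: measurableI => //; rewrite -[X in measurable X]setTI; exact: mY.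
Qed.

(** [k] is the Radon-Nikodym derivative of [joint] with respect to [law]. Both live on [S], so the
    conditional probability is a function of [Y] by construction. *)
Lemma conditional_probability_exists : exists k : S -> R,
  [/\ measurable_fun [set: S] k, forall y, 0 <= k y &
    forall B, measurable B ->
      P (A `&` Y @^-1` B) = (\int[P]_w (\1_B (Y w) * k (Y w))%:E)%E].
Proof.
pose lawF : {finite_measure set S -> \bar R} :=
  HB.pack (law : set S -> \bar R) (Measure.class law)
    (@Measure_isFinite.Build _ _ _ law law_fin).
pose jointF : {finite_measure set S -> \bar R} :=
  HB.pack (joint : set S -> \bar R) (Measure.class joint)
    (@Measure_isFinite.Build _ _ _ joint joint_fin).
have dom : jointF `<< lawF.
  apply/null_content_dominatesP => B mB lawB0.
  apply/eqP; rewrite eq_le measure_ge0 andbT -lawB0.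
  have mYB : measurable (Y @^-1` B).
    by rewrite -[X in measurable X]setTI; exact: mY.
  apply: (@le_measure _ _ _ P); rewrite ?inE//; exact: measurableI.
have [f [f0 ffin intf fE]] := radon_nikodym_sigma_finite dom.
have mf : measurable_fun [set: S] f by exact: measurable_int intf.
exists (fine \o f); split.
- exact: measurableT_comp.
- by move=> y; exact: fine_ge0.
move=> B mB; rewrite setIC -[LHS]/(jointF B) fE//.
rewrite integral_mkcond.
transitivity (\int[law]_y (\1_B y * fine (f y))%:E)%E.
  apply: eq_integral => y _; rewrite patchE indicE; case: (_ \in _).
    by rewrite mul1r fineK.
  by rewrite mul0r.
rewrite ge0_integral_mpushforward//.
- apply/measurable_EFinP; apply: measurable_funM; first exact: measurable_indic.
  exact: measurableT_comp.
- by move=> y; rewrite lee_fin mulr_ge0// fine_ge0.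
Qed.

End conditional_probability.

(** * The two-power Rayleigh model *)

Section model.
Context (R : realType) (d : measure_display) (T : measurableType d).
Variables (P : 'cV[R]_2 -> probability T R) (N : nat) (N_gt0 : (0 < N)%N).
Variables (Ps : 'I_2 -> R) (Ps2_ge0 : 0 <= Ps ord_max).
Hypothesis Ps_lt : Ps ord_max < Ps ord0.
Variables (S : 'I_2 -> 'I_N -> R).
Hypothesis S_power : forall l i, `|S l i| ^+ 2 = Ps l.
Variables (H V : 'I_2 -> 'I_N -> T -> R[i]).
Hypothesis H_gaussian : forall t, true_params t -> forall im l i,
  gaussian (P t) 0 (sigma2H t) (fun w => re_im im (H l i w)).
Hypothesis V_gaussian : forall t, true_params t -> forall im l i,
  gaussian (P t) 0 (sigma2V t) (fun w => re_im im (V l i w)).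
Hypothesis HV_indep : forall t, true_params t ->
  mutually_independent (P t) (parts H V).

Let X := received S H V.

(** * The samples as independent Gaussian coordinates *)

Definition coordinates := (bool * ('I_2 * 'I_N))%type.

Definition coordinate (j : coordinates) (w : T) : R :=
  re_im j.1 (received S H V w j.2.1 j.2.2).

Definition std_dev (t : 'cV[R]_2) (j : coordinates) : R :=
  Num.sqrt (power Ps t j.2.1).

Lemma coordinateE j w : coordinate j w =
  S j.2.1 j.2.2 * parts H V (false, j.1, j.2) w + parts H V (true, j.1, j.2) w.
Proof.
case: j => im [l i]; rewrite /coordinate /received /parts /= mulrC.
case: (H l i w) => a b; case: (V l i w) => a' b'.
by case: im => /=; rewrite ?mulr0 ?mul0r ?subr0 ?addr0 ?add0r// mulrC.
Qed.

Lemma sqr_S l i : S l i ^+ 2 = Ps l.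
Proof. by rewrite -(S_power l i) real_normK// num_real. Qed.

Lemma Ps_ge0 l : 0 <= Ps l.
Proof. by rewrite -(sqr_S l (Ordinal N_gt0)) sqr_ge0. Qed.

Lemma Ps1_gt0 : 0 < Ps ord0. Proof. exact: le_lt_trans Ps_lt. Qed.

Lemma power_gt0 t l : true_params t -> 0 < power Ps t l.
Proof. by case=> h v; rewrite /power ltr_wpDl// mulr_ge0 ?Ps_ge0 ?ltW. Qed.

Lemma std_dev_gt0 t j : true_params t -> 0 < std_dev t j.
Proof. by move=> tt; rewrite sqrtr_gt0 power_gt0. Qed.

Lemma sqr_std_dev t j : true_params t -> std_dev t j ^+ 2 = power Ps t j.2.1.
Proof. by move=> tt; rewrite sqr_sqrtr// ltW// power_gt0. Qed.

(** A reference parameter: the hypotheses speak of true parameters only, and measurability of the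
    gains and noises is read off at this one. It is also the fixed parameter of the sufficiency
    proof. *)
Lemma true_params1 : @true_params R (const_mx 1).
Proof. by rewrite /true_params/= /sigma2H /sigma2V !mxE. Qed.

Lemma measurable_parts k : measurable_fun [set: T] (parts H V k).
Proof.
case: k => [[[] im] [l i]] /=.
  exact: (V_gaussian true_params1 im l i).1.
exact: (H_gaussian true_params1 im l i).1.
Qed.

Lemma measurable_coordinate j : measurable_fun [set: T] (coordinate j).
Proof.
have -> : coordinate j = fun w => S j.2.1 j.2.2 * parts H V (false, j.1, j.2) w +
    parts H V (true, j.1, j.2) w by apply/funext => w; exact: coordinateE.
apply: measurable_funD; last exact: measurable_parts.
by apply: measurable_funM => //; exact: measurable_parts.
Qed.

Lemma prod_parts (F : (bool * bool) * ('I_2 * 'I_N) -> \bar R) :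
  (\prod_(k in [set: (bool * bool) * ('I_2 * 'I_N)]%SET) F k =
   \prod_(j : coordinates) (F (false, j.1, j.2) * F (true, j.1, j.2)))%E.
Proof.
pose h (k : bool * coordinates) := ((k.1, k.2.1), k.2.2).
rewrite (reindex h)/=; last first.
  exists (fun k => (k.1.1, (k.1.2, k.2))) => [[b [b' l]]|[[b b'] l]] //.
under eq_bigl do rewrite inE.
rewrite -(pair_bigA _ (fun b j => F (h (b, j))))/=.
rewrite exchange_big/=; apply: eq_bigr => j _.
by rewrite big_bool muleC.
Qed.

(** Pairing each gain component with its noise component gives independent pairs of product law,
    first on rectangles and then on all measurable sets of the plane. A coordinate is a linear form
    of its own pair, whose law is a convolution of normal laws. *)
Lemma coordinate_laws t : true_params t ->
  @independent_with_laws _ _ T (measurableTypeR R) R (P t) coordinates coordinate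
    (fun j => normal_prob 0 (std_dev t j)) measurable.
Proof.
move=> tt E mE; have [h0 v0] := tt.
pose a := Num.sqrt (sigma2H t); pose b := Num.sqrt (sigma2V t).
have a0 : 0 < a by rewrite sqrtr_gt0.
have b0 : 0 < b by rewrite sqrtr_gt0.
pose Z (j : coordinates) w : measurableTypeR R * measurableTypeR R := (parts H V (false, j.1, j.2) w, parts H V (true, j.1, j.2) w).
have mZ j : measurable_fun [set: T] (Z j).
  by apply: measurable_fun_pair; exact: measurable_parts.
pose nu (j : coordinates) : probability _ _ := (normal_prob 0 a \x normal_prob 0 b)%E.
pose G : set (set (measurableTypeR R * measurableTypeR R)) :=
  [set A `*` B | A in measurable & B in measurable].
have GI : setI_closed G.
  move=> _ _ [A1 mA1 [B1 mB1 <-]] [A2 mA2 [B2 mB2 <-]].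
  exists (A1 `&` A2); first exact: measurableI.
  by exists (B1 `&` B2); [exact: measurableI|rewrite setXI].
have GT : G setT by exists setT => //; exists setT => //; rewrite setXTT.
have indG : independent_with_laws (P t) Z nu G.
  move=> F FG.
  have FE j : exists AB : set R * set R,
      [/\ measurable AB.1, measurable AB.2 & AB.1 `*` AB.2 = F j].
    by have [A mA [B mB <-]] := FG j; exists (A, B).
  have [AB ABP] := choice FE.
  pose A' (k : (bool * bool) * ('I_2 * 'I_N)) :=
    if k.1.1 then (AB (k.1.2, k.2)).2 else (AB (k.1.2, k.2)).1.
  have mA' k : measurable (A' k).
    by rewrite /A'; case: ifP => _; have [] := ABP (k.1.2, k.2).
  have -> : [set w | forall j, F j (Z j w)] =
      \bigcap_(k in [set` [set: (bool * bool) * ('I_2 * 'I_N)]%SET])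
        (parts H V k @^-1` A' k).
    apply/seteqP; split => w /=.
      move=> FZ [[n im] l] _ /=; have := FZ (im, l).
      by have [_ _ <-] := ABP (im, l) => -[]; rewrite /A'; case: n.
    move=> AZ [im l]; have [_ _ <-] := ABP (im, l).
    by split; [apply: (AZ (false, im, l))|apply: (AZ (true, im, l))]; rewrite /= inE.
  rewrite (HV_indep tt _ mA') prod_parts; apply: eq_bigr => -[im [l i]] _.
  have [m1 m2 <-] := ABP (im, (l, i)).
  rewrite [RHS]product_measure1E//; congr (_ * _)%E.
    exact: (H_gaussian tt im l i).2.
  exact: (V_gaussian tt im l i).2.
have indZ := independent_with_laws_generator mZ
  (measurable_prod_measurableType _ _) GI GT indG.
have mconv s : measurable_fun [set: R * R] (fun z => s * z.1 + z.2).
  by apply: measurable_funD => //; exact: measurable_funM.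
have mE' j : measurable [set z : R * R | E j (S j.2.1 j.2.2 * z.1 + z.2)].
  rewrite -[X in measurable X]setTI; exact: (mconv _ measurableT _ (mE j)).
rewrite (_ : [set w | _] = [set w | forall j,
    [set z : R * R | E j (S j.2.1 j.2.2 * z.1 + z.2)] (Z j w)]); last first.
  by apply/seteqP; split => w /= h j; have := h j; rewrite coordinateE.
rewrite (indZ _ mE'); apply: eq_bigr => j _.
apply: normal_prob_conv => //; first exact: std_dev_gt0.
  by rewrite sqr_std_dev// !sqr_sqrtr ?ltW// sqr_S.
exact: mE.
Qed.

Lemma ge0_integral_prod_coordinate t (f : coordinates -> R -> R)
    (c : coordinates -> R) : true_params t ->
  (forall j, measurable_fun [set: R] (f j)) -> (forall j x, 0 <= f j x) ->
  (forall j, \int[normal_prob 0 (std_dev t j)]_x (f j x)%:E = (c j)%:E)%E ->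
  (\int[P t]_w (\prod_(j : coordinates) f j (coordinate j w))%:E =
   (\prod_(j : coordinates) c j)%:E)%E.
Proof.
move=> tt mf f0 fc.
exact: (@ge0_integral_prod_independent _ _ T (measurableTypeR R) R (P t) _ _ _
  measurable_coordinate (coordinate_laws tt) f c mf f0 fc).
Qed.

(* Density of the law of the samples under [t'] with respect to that under [t]. *)
Definition likelihood_ratio t t' w : R :=
  \prod_(j : coordinates) normal_tilt (std_dev t j) (std_dev t' j) (coordinate j w).

Lemma measurable_likelihood_ratio t t' :
  measurable_fun [set: T] (likelihood_ratio t t').
Proof.
apply: measurable_prod => j _; apply: measurableT_comp.
  exact: measurable_normal_tilt.
exact: measurable_coordinate.
Qed.

Lemma likelihood_ratio_ge0 t t' : true_params t -> true_params t' ->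
  forall w, 0 <= likelihood_ratio t t' w.
Proof.
move=> tt tt' w; apply: prodr_ge0 => j _.
by rewrite normal_tilt_ge0 ?std_dev_gt0.
Qed.

Lemma sample_events_measurable E : <<s sample_events X >> E -> measurable E.
Proof.
apply: (smallest_sub (@sigma_algebra_measurable _ T)).
move=> _ [im [l [i [B [mB ->]]]]].
rewrite -[X in measurable X]setTI.
exact: (measurable_coordinate (im, (l, i))).
Qed.

(** Boxes in the coordinates form a pi-system generating the sample events, and on a box both sides
    factor into one-dimensional normal laws. On events involving gains and noises separately the
    density would be a different one. *)
Lemma likelihood_ratioP t t' (tt : true_params t) (tt' : true_params t') E :
  <<s sample_events X >> E ->
  P t' E = mdensity (P t) (measurable_likelihood_ratio t t')
    (likelihood_ratio_ge0 tt tt') E.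
Proof.
move=> XE.
pose G : set (set T) := [set A | exists2 B : coordinates -> set R,
  forall j, measurable (B j) & A = [set w | forall j, B j (coordinate j w)]].
have Gm : G `<=` measurable.
  move=> _ [B mB ->].
  rewrite (_ : [set w | _] = \bigcap_(j in [set: coordinates]) (coordinate j @^-1` B j)).
    apply: fin_bigcap_measurable; first exact: finite_finset.
    move=> j _.
    by rewrite -[X in measurable X]setTI; exact: measurable_coordinate.
  by apply/seteqP; split => w /= h j; [move=> _|]; exact: h.
have GT : G setT.
  by exists (fun=> setT) => //; apply/seteqP; split.
apply: (g_sigma_algebra_measure_unique G Gm (fun=> setT)) => //.
- by rewrite bigcup_const//; exists 0%N.
- move=> _ _ [A mA ->] [B mB ->]; exists (fun j => A j `&` B j).
    by move=> j; exact: measurableI.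
  apply/seteqP; split => w /=; first by move=> [hA hB] j; split.
  by move=> h; split=> j; have [] := h j.
- move=> _ [B mB ->]; transitivity (\prod_(j : coordinates) normal_prob 0 (std_dev t' j) (B j))%E.
    exact: (coordinate_laws tt' mB).
  rewrite /= /mdensity.
  rewrite integral_mkcond.
  pose f j x : R := \1_(B j) x * normal_tilt (std_dev t j) (std_dev t' j) x.
  transitivity (\int[P t]_w (\prod_(j : coordinates) f j (coordinate j w))%:E)%E; last first.
    apply: eq_integral => w _; rewrite patchE /f big_split/=.
    rewrite -/(likelihood_ratio t t' w).
    have [hw|hw] := pselect (forall j, B j (coordinate j w)).
      rewrite mem_set// big1 ?mul1r// => j _.
      by rewrite indicE mem_set//; exact: hw.
    rewrite memNset//; have [j hj] := (existsNP _).2 hw.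
    by rewrite (bigD1 j)//= indicE memNset//= !mul0r.
  rewrite (ge0_integral_prod_coordinate tt
    (c := fun j => fine (normal_prob 0 (std_dev t' j) (B j)))).
  + rewrite -prodEFin; apply: eq_bigr => j _.
    by rewrite fineK//; apply: fin_num_measure; exact: mB.
  + move=> j; apply: measurable_funM; first exact: measurable_indic.
    exact: measurable_normal_tilt.
  + by move=> j x; rewrite mulr_ge0// normal_tilt_ge0 ?std_dev_gt0.
  + move=> j; under eq_integral do rewrite EFinM.
    rewrite ge0_integral_normal_tilt ?std_dev_gt0//.
      rewrite fineK; first by rewrite integral_indic ?setIT//; exact: mB.
      by apply: fin_num_measure; exact: mB.
    by apply/measurable_EFinP; exact: measurable_indic.
- move=> _; apply: (@le_lt_trans _ _ 1%E); last exact: ltry.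
  exact: probability_le1.
- move: XE; apply: smallest_sub; first exact: smallest_sigma_algebra.
  move=> _ [im [l [i [B [mB ->]]]]]; apply: sub_sigma_algebra.
  exists (fun j => if j == (im, (l, i)) then B else setT).
    by move=> j; case: ifP.
  apply/seteqP; split => w /=.
    by move=> Bw j; case: eqP => // ->.
  by move=> /(_ (im, (l, i))); rewrite eqxx.
Qed.


(** * Mean squares and the likelihood ratio *)

Lemma sum_ord2 (F : 'I_2 -> R) : \sum_(l < 2) F l = F ord0 + F ord_max.
Proof.
by rewrite big_ord_recl big_ord1; congr (_ + F _); exact: val_inj.
Qed.

Lemma ord2P (l : 'I_2) : l = ord0 \/ l = ord_max.
Proof. by case: l => -[|[|//]] i; [left|right]; exact: val_inj. Qed.

Lemma mean_squareE l w : mean_square (X w) l =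
  (2 * N)%:R^-1 * \sum_(i < N) \sum_(b : bool) coordinate (b, (l, i)) w ^+ 2.
Proof.
congr (_ * _); apply: eq_bigr => i _; rewrite big_bool/= /coordinate/= /X.
case: (received S H V w l i) => a b /=.
by rewrite /ComplexField.Normc.normc sqr_sqrtr ?addr_ge0 ?sqr_ge0// addrC.
Qed.

Lemma mean_square_ge0 l w : 0 <= mean_square (X w) l.
Proof.
rewrite mean_squareE mulr_ge0 ?invr_ge0//.
by apply: sumr_ge0 => i _; apply: sumr_ge0 => b _; exact: sqr_ge0.
Qed.

Lemma sum_coordinates (F : coordinates -> R) :
  \sum_(j : coordinates) F j = \sum_(l < 2) \sum_(i < N) \sum_(b : bool) F (b, (l, i)).
Proof.
transitivity (\sum_(b : bool) \sum_(li : 'I_2 * 'I_N) F (b, li)).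
  by rewrite [RHS](pair_bigA _ (fun b li => F (b, li)))/=; apply: eq_bigr => -[].
rewrite exchange_big/=.
rewrite [RHS](pair_bigA _ (fun l i => \sum_b F (b, (l, i))))/=.
by apply: eq_bigr => -[].
Qed.

(** The exponents [x ^+ 2 / 2] of the [2 * N] coordinates in group [l] add up to [N] times its mean
    square. This is an exponential family whose natural parameters are, up to a factor, the
    reciprocals of the powers. *)
Lemma likelihood_ratioE t t' : true_params t -> true_params t' ->
  exists2 C : R, 0 < C & forall w, likelihood_ratio t t' w =
    C * expR (- \sum_(l < 2) N%:R * mean_square (X w) l *
      ((power Ps t' l)^-1 - (power Ps t l)^-1)).
Proof.
move=> tt tt'; exists (\prod_(j : coordinates) (std_dev t j / std_dev t' j)).
  by apply: prodr_gt0 => j _; rewrite divr_gt0 ?std_dev_gt0.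
move=> w; rewrite /likelihood_ratio big_split/=; congr (_ * _).
rewrite -expR_sum sumrN; congr (expR (- _)).
rewrite sum_coordinates; apply: eq_bigr => l _.
rewrite mean_squareE mulrA.
have -> : N%:R * (2 * N)%:R^-1 = 2^-1 :> R.
  by rewrite natrM; field; rewrite pnatr_eq0 -lt0n.
rewrite mulr_sumr mulr_suml; apply: eq_bigr => i _.
rewrite mulr_sumr mulr_suml; apply: eq_bigr => b _.
by rewrite !sqr_std_dev//= [2^-1 * _]mulrC.
Qed.

Lemma is_statisticP d' (U : measurableType d') (Y : T -> U) :
  is_statistic X Y <->
  @measurable_fun _ _ (g_sigma_algebraType (sample_events X)) U setT Y.
Proof.
split=> [Ys _ B mB|mY B mB]; first by rewrite setTI; exact: Ys.
by have := mY measurableT B mB; rewrite setTI.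
Qed.

Lemma is_statistic_measurable d' (U : measurableType d') (Y : T -> U) :
  is_statistic X Y -> measurable_fun [set: T] Y.
Proof.
by move=> Ys _ B mB; rewrite setTI; apply: sample_events_measurable; exact: Ys.
Qed.

Lemma is_statistic_mean_square l : is_statistic X (fun w => mean_square (X w) l).
Proof.
apply/is_statisticP.
have -> : (fun w => mean_square (X w) l) = (fun w => (2 * N)%:R^-1 *
    \sum_(i < N) \sum_(b : bool) coordinate (b, (l, i)) w ^+ 2).
  by apply/funext => w; exact: mean_squareE.
apply: measurable_funM => //; apply: measurable_sum => i.
apply: measurable_sum => b; apply: measurable_funX.
move=> _ B mB; rewrite setTI; apply: sub_sigma_algebra.
by exists b, l, i, B.
Qed.

Lemma ge0_integral_likelihood_ratio t t' d' (U : measurableType d') (Y : T -> U)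
    (f : U -> R) :
  true_params t -> true_params t' -> is_statistic X Y ->
  measurable_fun [set: U] f -> (forall y, 0 <= f y) ->
  (\int[P t']_w (f (Y w))%:E = \int[P t]_w (f (Y w) * likelihood_ratio t t' w)%:E)%E.
Proof.
move=> tt tt' sY mf f0.
have mY := is_statistic_measurable sY.
have mh := measurable_likelihood_ratio t t'.
have h0 := likelihood_ratio_ge0 tt tt'.
transitivity (\int[mdensity (P t) mh h0]_w (f (Y w))%:E)%E.
  apply: (@eq_ge0_integral_comp _ _ T U R (P t') (mdensity (P t) mh h0) Y
    (EFin \o f) mY) => [B mB||y].
  - exact: (likelihood_ratioP tt tt' (sY _ mB)).
  - exact/measurable_EFinP.
  - by rewrite lee_fin.
rewrite (ge0_integral_mdensity _ mh h0 (f := fun w => (f (Y w))%:E))//.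
  by apply/measurable_EFinP; exact: measurableT_comp.
by move=> w; rewrite lee_fin.
Qed.

Lemma integral_likelihood_ratio t t' (D : T -> R) :
  true_params t -> true_params t' -> is_statistic X D ->
  (P t').-integrable [set: T] (EFin \o D) ->
  (P t).-integrable [set: T] (fun w => (D w * likelihood_ratio t t' w)%:E) /\
  (\int[P t]_w (D w * likelihood_ratio t t' w)%:E = \int[P t']_w (D w)%:E)%E.
Proof.
move=> tt tt' sD intD; pose h := likelihood_ratio t t'.
have mD := is_statistic_measurable sD.
have mh := measurable_likelihood_ratio t t'.
have h0 := likelihood_ratio_ge0 tt tt'.
have ge0E (f : R -> R) : measurable_fun [set: R] f -> (forall x, 0 <= f x) ->
    (\int[P t']_w (f (D w))%:E = \int[P t]_w (f (D w) * h w)%:E)%E.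
  by move=> mf f0; exact: ge0_integral_likelihood_ratio.
(* The two parts are functions on [R] composed with [D], so the nonnegative case applies with
   [Y := D]. *)
pose pos (x : R) := Num.max x 0; pose neg (x : R) := Num.max (- x) 0.
have mpos : measurable_fun [set: R] pos by exact: measurable_maxr.
have mneg : measurable_fun [set: R] neg.
  by apply: measurable_maxr => //; exact: measurableT_comp.
have pos0 x : 0 <= pos x by rewrite /pos le_max lexx orbT.
have neg0 x : 0 <= neg x by rewrite /neg le_max lexx orbT.
have posneg x : x = pos x - neg x.
  by rewrite /pos /neg; case: (leP x 0) => hx; case: (leP (- x) 0) => hx'; lra.
have intp : (P t').-integrable setT (fun w => (pos (D w))%:E).
  have := integrable_funepos measurableT intD.
  by rewrite funerpos.
have intn : (P t').-integrable setT (fun w => (neg (D w))%:E).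
  have := integrable_funeneg measurableT intD.
  by rewrite funerneg.
have int_h (f : R -> R) : measurable_fun [set: R] f -> (forall x, 0 <= f x) ->
    (P t').-integrable setT (fun w => (f (D w))%:E) ->
    (P t).-integrable setT (fun w => (f (D w) * h w)%:E).
  move=> mf f0 intf.
  apply: (@ge0_integral_fin_integrable _ _ _ _ (fun w => f (D w) * h w)
    (fine (\int[P t']_w (f (D w))%:E)%E)).
  - by apply: measurable_funM => //; exact: measurableT_comp.
  - by move=> w; rewrite mulr_ge0// h0.
  - by rewrite -ge0E// fineK//; exact: integrable_fin_num.
have intph := int_h _ mpos pos0 intp; have intnh := int_h _ mneg neg0 intn.
have DhE : (fun w => (D w * h w)%:E) =
    (fun w => (pos (D w) * h w)%:E - (neg (D w) * h w)%:E)%E.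
  by apply/funext => w; rewrite -EFinB -mulrBl -posneg.
have DE : (fun w => (D w)%:E) = (fun w => (pos (D w))%:E - (neg (D w))%:E)%E.
  by apply/funext => w; rewrite -EFinB -posneg.
split; first by rewrite DhE; exact: integrableB.
rewrite DhE DE integralB// [in RHS]integralB//.
by rewrite !ge0E.
Qed.

(** * Statistics whose mean is zero under every parameter *)

Definition params_of (p1 p2 : R) : 'cV[R]_2 :=
  \col_(k < 2) (if k == ord0 then (p1 - p2) / (Ps ord0 - Ps ord_max)
    else (Ps ord0 * p2 - Ps ord_max * p1) / (Ps ord0 - Ps ord_max)).

Lemma true_params_of p1 p2 : p2 < p1 -> Ps ord_max * p1 < Ps ord0 * p2 ->
  true_params (params_of p1 p2).
Proof.
move=> h1 h2; rewrite /true_params/= /sigma2H /sigma2V !mxE/=.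
by split; rewrite divr_gt0 ?subr_gt0.
Qed.

(** [params_of] thus inverts the linear map from parameters to powers; at the observed mean squares
    it is the estimate [theta_hat]. *)
Lemma power_params_of p1 p2 :
  power Ps (params_of p1 p2) ord0 = p1 /\ power Ps (params_of p1 p2) ord_max = p2.
Proof.
have D0 : Ps ord0 - Ps ord_max != 0 by rewrite gt_eqF ?subr_gt0.
by rewrite /power /sigma2H /sigma2V !mxE/=; split; field.
Qed.

(* Tilting by [expR (- v . stat)] stays in the model when [v] ranges over a convex
   cone of reciprocal powers, so that the bounded variables [expR (- v_k . stat)],
   for two independent directions [v_1, v_2], have vanishing joint moments against
   [D]. *)
Lemma unbiased_zero_orthogonal (D : T -> R) : is_statistic X D ->
  (forall t, true_params t -> (P t).-integrable [set: T] (EFin \o D) /\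
    (\int[P t]_w (D w)%:E = 0)%E) ->
  forall t, true_params t -> forall B : set (R * R), measurable B ->
  (\int[P t]_(w in (fun w => (mean_square (X w) ord0, mean_square (X w) ord_max)) @^-1` B)
     (D w)%:E = 0)%E.
Proof.
move=> sD D0 t tt B mB.
have Ps10 := Ps1_gt0.
pose rho := Ps ord_max / Ps ord0.
have rhoE : Ps ord0 * rho = Ps ord_max by rewrite /rho mulrC divfK// gt_eqF.
have rho1 : rho < 1 by rewrite ltr_pdivrMr// mul1r.
have rho0 : 0 <= rho by rewrite divr_ge0// ltW.
(* In reciprocal powers the true parameters satisfy [rho * r1 < r0 < r1]. The slopes [al] and [be]
   lie one half and one quarter of the way from [rho] to 1, so [(al, 1)] and [(be, 1)] are
   independent directions inside this cone. *)
pose al := (1 + rho) / 2; pose be := (1 + 3 * rho) / 4.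
have NR : 0 < N%:R :> R by rewrite ltr0n.
pose m0 w := mean_square (X w) ord0; pose m1 w := mean_square (X w) ord_max.
pose Z (a : R) w := expR (- (N%:R * (a * m0 w + m1 w))).
have mm l : measurable_fun [set: T] (fun w => mean_square (X w) l).
  exact: is_statistic_measurable (is_statistic_mean_square l).
have mZ a : measurable_fun [set: T] (Z a).
  apply: measurableT_comp => //; apply: measurableT_comp => //.
  apply: measurable_funM => //; apply: measurable_funD; last exact: mm.
  by apply: measurable_funM => //; exact: mm.
have Z01 a : 0 <= a -> forall w, 0 <= Z a w <= 1.
  move=> a0 w; rewrite expR_ge0/= -expR0 ler_expR oppr_le0.
  apply: mulr_ge0; first exact: ltW.
  by apply: addr_ge0; [apply: mulr_ge0 => //|]; exact: mean_square_ge0.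
have mom m n : (\int[P t]_w (D w * Z al w ^+ m * Z be w ^+ n)%:E = 0)%E.
  pose r0 := (power Ps t ord0)^-1; pose r1 := (power Ps t ord_max)^-1.
  (* Reciprocal powers of [t], moved [m] times along [(al, 1)] and [n] times along [(be, 1)]. Up to
     a constant, the likelihood ratio towards them is [Z al ^+ m * Z be ^+ n]. *)
  pose s0 := r0 + (m%:R * al + n%:R * be); pose s1 := r1 + (m%:R + n%:R).
  have [h0 v0] := tt.
  have p0 := power_gt0 ord0 tt; have p1 := power_gt0 ord_max tt.
  have r0_gt0 : 0 < r0 by rewrite invr_gt0.
  have r1_gt0 : 0 < r1 by rewrite invr_gt0.
  have r01 : r0 < r1.
    rewrite ltf_pV2 ?posrE// /power ltrD2r ltr_pM2r//.
  have Pr : Ps ord_max * r1 < Ps ord0 * r0.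
    rewrite ltr_pdivrMr// mulrAC ltr_pdivlMr//.
    rewrite /power; rewrite -subr_gt0.
    rewrite (_ : _ - _ = (Ps ord0 - Ps ord_max) * sigma2V t); last by ring.
    by rewrite mulr_gt0// subr_gt0.
  have m_ge0 : 0 <= m%:R :> R by []; have n_ge0 : 0 <= n%:R :> R by [].
  have mrho : m%:R * rho <= m%:R by rewrite ler_piMr// ltW.
  have nrho : n%:R * rho <= n%:R by rewrite ler_piMr// ltW.
  have mrho0 : 0 <= m%:R * rho by rewrite mulr_ge0.
  have nrho0 : 0 <= n%:R * rho by rewrite mulr_ge0.
  have s01 : s0 < s1 by rewrite /s0 /s1 /al /be; lra.
  have s0_gt0 : 0 < s0 by rewrite /s0 /al /be; lra.
  have s1_gt0 : 0 < s1 by rewrite /s1; lra.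
  have Pss : Ps ord_max * s1 < Ps ord0 * s0.
    rewrite /s0 /s1 /al /be !mulrDr; rewrite -subr_gt0.
    rewrite (_ : _ - _ = (Ps ord0 * r0 - Ps ord_max * r1) +
      m%:R * ((Ps ord0 + Ps ord0 * rho) / 2 - Ps ord_max) +
      n%:R * ((Ps ord0 + 3 * (Ps ord0 * rho)) / 4 - Ps ord_max)); last by ring.
    rewrite rhoE.
    have q1 : 0 <= m%:R * ((Ps ord0 + Ps ord_max) / 2 - Ps ord_max).
      by apply: mulr_ge0 => //; have := Ps_lt; lra.
    have q2 : 0 <= n%:R * ((Ps ord0 + 3 * Ps ord_max) / 4 - Ps ord_max).
      by apply: mulr_ge0 => //; have := Ps_lt; lra.
    lra.
  pose t' := params_of s0^-1 s1^-1.
  have tt' : true_params t'.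
    apply: true_params_of; first by rewrite ltf_pV2 ?posrE.
    by rewrite ltr_pdivrMr// mulrAC ltr_pdivlMr.
  have [E0 E1] := power_params_of s0^-1 s1^-1.
  have [C C0 CE] := likelihood_ratioE tt tt'.
  have [intD D0'] := D0 _ tt'.
  have [inth] := integral_likelihood_ratio tt tt' sD intD.
  rewrite D0' => intE.
  have -> : (fun w => (D w * Z al w ^+ m * Z be w ^+ n)%:E) =
      (fun w => C^-1%:E * (D w * likelihood_ratio t t' w)%:E)%E.
    apply/funext => w; rewrite -EFinM; congr EFin; rewrite CE.
    rewrite [D w * (C * _)]mulrCA mulKf ?gt_eqF// -mulrA; congr (_ * _).
    rewrite -!expRM_natl -expRD; congr expR; rewrite sum_ord2 E0 E1 !invrK.
    rewrite -/(m0 w) -/(m1 w) -/r0 -/r1 /s0 /s1; ring.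
  by rewrite integralZl// intE mule0.
have al0 : 0 <= al by rewrite /al; lra.
have be0 : 0 <= be by rewrite /be; lra.
have ab : al - be != 0 by rewrite gt_eqF// /al /be; lra.
(* Logarithms of [Z al] and [Z be] give a linear system for the mean squares with determinant
   proportional to [al - be]. Solving it makes every event of the mean squares an event of the two
   bounded variables. *)
pose phi (z : R * R) : R * R :=
  let x := (ln z.2 - ln z.1) / (N%:R * (al - be)) in (x, - (ln z.1) / N%:R - al * x).
have mphi : measurable_fun [set: R * R] phi.
  have m1' : measurable_fun [set: R * R] (fun z : R * R => ln z.1).
    by apply: measurableT_comp => //; exact: measurable_ln.
  have m2' : measurable_fun [set: R * R] (fun z : R * R => ln z.2).
    by apply: measurableT_comp => //; exact: measurable_ln.
  have mx : measurable_fun [set: R * R]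
      (fun z : R * R => (ln z.2 - ln z.1) / (N%:R * (al - be))).
    by apply: measurable_funM => //; exact: measurable_funB.
  apply: measurable_fun_pair => //; apply: measurable_funB.
    by apply: measurable_funM => //; exact: measurableT_comp.
  exact: measurable_funM.
have phiE w : phi (Z al w, Z be w) = (m0 w, m1 w).
  rewrite /phi /Z /= !expRK.
  have -> : (- (N%:R * (be * m0 w + m1 w)) - - (N%:R * (al * m0 w + m1 w))) /
      (N%:R * (al - be)) = m0 w by field; rewrite ab gt_eqF.
  by congr pair; field; rewrite gt_eqF.
rewrite (_ : _ @^-1` B = (fun w => (Z al w, Z be w)) @^-1` (phi @^-1` B)); last first.
  by apply/seteqP; split => w /=; rewrite phiE.
apply: vanishing_moments2 => //.
- exact: Z01.
- exact: Z01.
- exact: (D0 _ tt).1.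
- by rewrite -[X in measurable X]setTI; exact: mphi.
Qed.

(** * First and second moments of the mean squares *)

Definition even_moment (p : R) (k : nat) : R :=
  if k is 0 then 1 else if k is 1 then p else 3 * p ^+ 2.

(** Even powers keep the integrand nonnegative, as the product formula requires. The last branch of
    [even_moment] is the fourth moment, whence the bound on [a]. Exponents built from Kronecker
    deltas then cover equal and distinct coordinates uniformly. *)
Lemma even_moments t (a : coordinates -> nat) : true_params t ->
  (forall j, (a j <= 2)%N) ->
  has_mean (P t) (fun w => \prod_(j : coordinates) coordinate j w ^+ (2 * a j))
    (\prod_(j : coordinates) even_moment (power Ps t j.2.1) (a j)).
Proof.
move=> tt a2; apply: has_mean_ge0.
- apply: measurable_prod => j _; apply: measurable_funX.
  exact: measurable_coordinate.
- by move=> w; apply: prodr_ge0 => j _; rewrite exprM exprn_ge0// sqr_ge0.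
apply: (ge0_integral_prod_coordinate (f := fun j x => x ^+ (2 * a j)) tt).
- by move=> j; exact: measurable_funX.
- by move=> j x; rewrite exprM exprn_ge0// sqr_ge0.
move=> j; have s0 := std_dev_gt0 j tt; rewrite -(sqr_std_dev j tt).
case: (a j) (a2 j) => [|[|[|//]]] _ /=.
- under eq_integral do rewrite muln0 expr0.
  etransitivity.
    exact: (@integral_cst _ (measurableTypeR R) R (normal_prob 0 (std_dev t j)) _
      measurableT 1%E).
  by rewrite mul1e; exact: (@probability_setT _ _ _ (normal_prob 0 (std_dev t j))).
- exact: normal_second_moment.
- by rewrite -exprM; exact: normal_fourth_moment.
Qed.

Let delta_prod (F : coordinates -> nat -> R) (j : coordinates) :
  (forall i, F i 0 = 1) -> \prod_(i : coordinates) F i (i == j) = F j 1.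
Proof.
move=> F0; rewrite (bigD1 j)//= eqxx big1 ?mulr1// => i ij.
by rewrite (negbTE ij) F0.
Qed.

Lemma has_mean_sqr_coordinate t j : true_params t ->
  has_mean (P t) (fun w => coordinate j w ^+ 2) (power Ps t j.2.1).
Proof.
move=> tt; have := @even_moments t (fun i => (i == j) : nat) tt
  (fun i => leq_trans (leq_b1 (i == j)) (isT : (1 <= 2)%N)).
rewrite (delta_prod (F := fun i k => even_moment (power Ps t i.2.1) k))//=.
congr has_mean; apply/funext => w.
by rewrite (delta_prod (F := fun i k => coordinate i w ^+ (2 * k))).
Qed.

(** For [j = k] the fourth moment [3 * p ^+ 2] is split as [p * p + 2 * p ^+ 2], so the delta term
    is exactly the covariance of the squares. *)
Lemma has_mean_sqr_coordinateM t j k : true_params t ->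
  has_mean (P t) (fun w => coordinate j w ^+ 2 * coordinate k w ^+ 2)
    (power Ps t j.2.1 * power Ps t k.2.1 + (j == k)%:R * (2 * power Ps t j.2.1 ^+ 2)).
Proof.
move=> tt; have := @even_moments t (fun i => (i == j) + (i == k))%N tt
  (fun i => leq_add (leq_b1 _) (leq_b1 _)).
rewrite (_ : (fun w => \prod_i _) =
    fun w => coordinate j w ^+ 2 * coordinate k w ^+ 2); last first.
  apply/funext => w; under eq_bigr do rewrite mulnDr exprD.
  rewrite big_split/= (delta_prod (F := fun i k => coordinate i w ^+ (2 * k)))//.
  by rewrite (delta_prod (F := fun i k => coordinate i w ^+ (2 * k))).
have [<-|jk] := eqVneq j k.
  rewrite (bigD1 j)//= eqxx big1 ?mulr1 => [|i ij].
    by congr has_mean; rewrite /even_moment/=; ring.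
  by rewrite (negbTE ij).
rewrite (bigD1 j)//= (bigD1 k)//=; last by rewrite eq_sym.
rewrite !eqxx (negbTE jk) eq_sym (negbTE jk)/= mul0r addr0 big1 ?mulr1//.
by move=> i /andP[ij ik]; rewrite (negbTE ij) (negbTE ik).
Qed.

Definition centered t l w := mean_square (X w) l - power Ps t l.

Let NR_neq0 : N%:R != 0 :> R. Proof. by rewrite pnatr_eq0 -lt0n. Qed.

Lemma centeredE t l w : centered t l w = (2 * N)%:R^-1 *
  \sum_(i < N) \sum_(b : bool) (coordinate (b, (l, i)) w ^+ 2 - power Ps t l).
Proof.
rewrite /centered mean_squareE.
have -> : \sum_(i < N) \sum_(b : bool) (coordinate (b, (l, i)) w ^+ 2 - power Ps t l) =
    \sum_(i < N) \sum_(b : bool) coordinate (b, (l, i)) w ^+ 2 -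
    (2 * N)%:R * power Ps t l.
  under eq_bigr do rewrite sumrB.
  rewrite sumrB; congr (_ - _).
  rewrite !sumr_const card_bool card_ord -mulrnA.
  by rewrite -[in LHS]mulr_natl.
by rewrite mulrBr mulKf// pnatr_eq0 muln_eq0/= -lt0n.
Qed.

Lemma has_mean_centered t l : true_params t -> has_mean (P t) (centered t l) 0.
Proof.
move=> tt; have h : has_mean (P t) (fun w => (2 * N)%:R^-1 *
    \sum_(i < N) \sum_(b : bool) (coordinate (b, (l, i)) w ^+ 2 - power Ps t l))
    ((2 * N)%:R^-1 * \sum_(i < N) \sum_(b : bool) (power Ps t l - power Ps t l)).
  apply: has_meanZ; apply: has_mean_sum => i; apply: has_mean_sum => b.
  apply: has_meanB; last exact: has_mean_cst.
  exact: (has_mean_sqr_coordinate (b, (l, i)) tt).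
move: h; rewrite subrr big1 ?mulr0 => [|i _]; last by rewrite big1.
by congr has_mean; apply/funext => w; rewrite centeredE.
Qed.

(** Squares of distinct coordinates are uncorrelated. Within a group, [2 * N] diagonal terms
    [2 * p ^+ 2] divided by [(2 * N) ^ 2] leave [p ^+ 2 / N]. *)
Lemma has_mean_centeredM t l k : true_params t ->
  has_mean (P t) (fun w => centered t l w * centered t k w)
    ((l == k)%:R * (power Ps t l ^+ 2 / N%:R)).
Proof.
move=> tt; pose q l := power Ps t l.
have QQ j j' : has_mean (P t) (fun w => (coordinate j w ^+ 2 - q j.2.1) *
    (coordinate j' w ^+ 2 - q j'.2.1)) ((j == j')%:R * (2 * q j.2.1 ^+ 2)).
  have := has_meanD (has_meanB (has_meanB (has_mean_sqr_coordinateM j j' tt)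
    (has_meanZ (q j'.2.1) (has_mean_sqr_coordinate j tt)))
    (has_meanZ (q j.2.1) (has_mean_sqr_coordinate j' tt)))
    (has_mean_cst _ (q j.2.1 * q j'.2.1)).
  rewrite -/(q _) -/(q _).
  congr has_mean; last by ring.
  by apply/funext => w; ring.
have h : has_mean (P t) (fun w => ((2 * N)%:R^-1 * (2 * N)%:R^-1) *
    \sum_(i < N) \sum_(b : bool) \sum_(i' < N) \sum_(b' : bool)
      (coordinate (b, (l, i)) w ^+ 2 - q l) * (coordinate (b', (k, i')) w ^+ 2 - q k))
    (((2 * N)%:R^-1 * (2 * N)%:R^-1) *
    \sum_(i < N) \sum_(b : bool) \sum_(i' < N) \sum_(b' : bool)
      (((b, (l, i)) == (b', (k, i')) :> coordinates)%:R * (2 * q l ^+ 2))).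
  apply: has_meanZ; apply: has_mean_sum => i; apply: has_mean_sum => b.
  apply: has_mean_sum => i'; apply: has_mean_sum => b'.
  exact: (QQ (b, (l, i)) (b', (k, i'))).
move: h; congr has_mean.
  apply/funext => w; rewrite !centeredE -/(q l) -/(q k) mulrACA; congr (_ * _).
  rewrite mulr_suml; apply: eq_bigr => i _; rewrite mulr_suml; apply: eq_bigr => b _.
  by rewrite mulr_sumr; apply: eq_bigr => i' _; rewrite mulr_sumr.
have inner i b : \sum_(i' < N) \sum_(b' : bool)
      (((b, (l, i)) == (b', (k, i')) :> coordinates)%:R * (2 * q l ^+ 2)) =
    (l == k)%:R * (2 * q l ^+ 2).
  have [<-|lk] := eqVneq l k; last first.
    rewrite mul0r big1// => i' _; rewrite big1// => b' _.
    by rewrite !xpair_eqE (negbTE lk) /= andbF mul0r.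
  rewrite (bigD1 i)//= [X in _ + X]big1 ?addr0; last first.
    move=> i' ii; rewrite big1// => b' _.
    by rewrite !xpair_eqE [i == i']eq_sym (negbTE ii) !andbF mul0r.
  rewrite (bigD1 b)//= eqxx big1 ?addr0// => b' bb.
  by rewrite !xpair_eqE [b == b']eq_sym (negbTE bb) mul0r.
under eq_bigr do under eq_bigr do rewrite inner.
rewrite !sumr_const card_bool card_ord -mulrnA -[in LHS]mulr_natl -/(q l) natrM.
by field.
Qed.

Lemma has_mean_linear t (a b : R) : true_params t ->
  has_mean (P t) (fun w => a * mean_square (X w) ord0 + b * mean_square (X w) ord_max)
    (a * power Ps t ord0 + b * power Ps t ord_max).
Proof.
move=> tt; have := has_meanD
  (has_meanD (has_meanZ a (has_mean_centered ord0 tt)) (has_mean_cst _ (a * power Ps t ord0)))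
  (has_meanD (has_meanZ b (has_mean_centered ord_max tt)) (has_mean_cst _ (b * power Ps t ord_max))).
rewrite !mulr0 !add0r; congr has_mean; apply/funext => w; rewrite /centered; ring.
Qed.

(** * Completeness, minimum variance and sufficiency *)

Let stat w := (mean_square (X w) ord0, mean_square (X w) ord_max).

Lemma is_statistic_stat : is_statistic X stat.
Proof.
apply/is_statisticP; apply: measurable_fun_pair; apply/is_statisticP;
  exact: is_statistic_mean_square.
Qed.

Lemma measurable_stat : measurable_fun [set: T] stat.
Proof. exact: is_statistic_measurable is_statistic_stat. Qed.

Lemma is_statistic_comp d' d'' (U : measurableType d') (U' : measurableType d'')
    (Y : T -> U) (f : U -> U') : measurable_fun [set: U] f -> is_statistic X Y ->
  is_statistic X (f \o Y).
Proof. by move=> mf /is_statisticP mY; apply/is_statisticP; exact: measurableT_comp. Qed.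

Lemma unbiased_has_mean (g : 'cV[R]_2 -> R) (U : T -> R) :
  unbiased P g U <-> forall t, true_params t -> has_mean (P t) U (g t).
Proof.
split=> h t tt; have [h1 h2] := h t tt; split => //; move: h2; rewrite unlock//.
Qed.

(** The zero-mean statistic [g \o stat] is orthogonal to its own sign [u], so its absolute value has
    zero integral. *)
Lemma stat_complete : complete_statistic P X stat.
Proof.
split; first exact: is_statistic_stat.
move=> g mg g0 t tt.
have sD := is_statistic_comp mg is_statistic_stat.
have D0 t' : true_params t' -> has_mean (P t') (g \o stat) 0.
  by move=> tt'; have [h1 h2] := g0 t' tt'; split => //; move: h2; rewrite unlock.
have orth := unbiased_zero_orthogonal sD D0 tt.
pose u y : R := if 0 <= g y then 1 else -1.
have mu_ : measurable_fun setT u.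
  by apply: measurable_fun_ifT => //; exact: measurable_fun_ler.
have guE w : g (stat w) * u (stat w) = `|g (stat w)|.
  rewrite /u; case: ifPn => h; first by rewrite mulr1 ger0_norm.
  by rewrite mulrN1 ltr0_norm// ltNge.
have [b hb] : exists b, has_mean (P t) (fun w => (g \o stat) w * u (stat w)) b.
  apply: (@has_mean_le _ _ _ _ _ (fun w => `|g (stat w)|)
    (fine (\int[P t]_w (`|g (stat w)|)%:E)%E)).
  - by apply: measurable_funM; apply: measurableT_comp => //; exact: measurable_stat.
  - by move=> w /=; rewrite guE normr_id.
  - by apply: has_mean_integrable; exact: (integrable_norm (D0 t tt).1).
have [_ abs0] := has_mean_charge_orthogonal measurable_stat mu_ (D0 t tt) orth hb.
have mgs : measurable_fun setT (fun w => (g (stat w))%:E).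
  by apply/measurable_EFinP; exact: has_mean_measurable (D0 t tt).
have /(ae_eq_integral_abs (P t) measurableT mgs) : (\int[P t]_w `|(g (stat w))%:E| = 0)%E.
  by rewrite -[RHS]abs0; apply: eq_integral => w _ /=; rewrite guE.
apply: filterS => w /(_ I) /=.
by move=> [].
Qed.

(** A Pythagorean identity: [D = W - U] has zero mean under every parameter, hence is orthogonal to
    [U - g t], and the variance of [W] exceeds that of [U] by the mean of [D ^+ 2]. *)
Lemma linear_mv_estimate (a b : R) (g : 'cV[R]_2 -> R) :
  (forall t, a * power Ps t ord0 + b * power Ps t ord_max = g t) ->
  is_mv_estimate P X g
    (fun w => a * mean_square (X w) ord0 + b * mean_square (X w) ord_max).
Proof.
move=> gE; pose u (y : R * R) := a * y.1 + b * y.2.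
have mu_ : measurable_fun setT u.
  by apply: measurable_funD; apply: measurable_funM.
pose U w := u (stat w).
have sU : is_statistic X U by exact: (is_statistic_comp mu_ is_statistic_stat).
have Ug t : true_params t -> has_mean (P t) U (g t).
  by move=> tt; rewrite -gE; exact: has_mean_linear.
split => //; first by apply/unbiased_has_mean => t tt; exact: Ug.
move=> W sW /unbiased_has_mean Wg t tt.
rewrite -/U /variance unlock.
rewrite (has_mean_expectation (Ug _ tt)) (has_mean_expectation (Wg _ tt))/=.
rewrite expectation.unlock.
rewrite -[leLHS]/(\int[P t]_w ((U w - g t) * (U w - g t))%:E)%E.
rewrite -[leRHS]/(\int[P t]_w ((W w - g t) * (W w - g t))%:E)%E.
have mU := is_statistic_measurable sU; have mW := is_statistic_measurable sW.
have [Woo|Wfin] := eqVneq (\int[P t]_w ((W w - g t) * (W w - g t))%:E)%E +oo%E.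
  by rewrite [leRHS]Woo leey.
have mW2 : measurable_fun setT (fun w => (W w - g t) * (W w - g t)).
  by apply: measurable_funM; exact: measurable_funB.
have W2_ge0 w : 0 <= (W w - g t) * (W w - g t) by rewrite -expr2 sqr_ge0.
pose vW := fine (\int[P t]_w ((W w - g t) * (W w - g t))%:E)%E.
have hW : has_mean (P t) (fun w => (W w - g t) * (W w - g t)) vW.
  apply: has_mean_ge0 => //; rewrite fineK// ge0_fin_numE ?ltey//.
  by apply: integral_ge0 => w _; rewrite lee_fin.
have [vU hU] : exists vU, has_mean (P t) (fun w => (U w - g t) * (U w - g t)) vU.
  eexists; have := has_meanD (has_meanD
    (has_meanZ (a * a) (has_mean_centeredM ord0 ord0 tt))
    (has_meanZ (b * b) (has_mean_centeredM ord_max ord_max tt)))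
    (has_meanZ (2 * a * b) (has_mean_centeredM ord0 ord_max tt)).
  rewrite (_ : (fun w => _ + _) = fun w => (U w - g t) * (U w - g t)); first exact.
  by apply/funext => w; rewrite /U /u /centered -gE /=; ring.
pose D w := W w - U w.
have sD : is_statistic X D.
  by apply/is_statisticP; apply: measurable_funB; exact/is_statisticP.
have D0 t' : true_params t' -> has_mean (P t') D 0.
  by move=> tt'; have := has_meanB (Wg _ tt') (Ug _ tt'); rewrite subrr.
have orth := unbiased_zero_orthogonal sD D0 tt.
(* With [x = W - g] and [y = U - g], the product is controlled by
   [|(x - y) * y| <= x ^+ 2 + 2 * y ^+ 2]. *)
have [c hc] : exists c, has_mean (P t) (fun w => D w * (u (stat w) - g t)) c.
  apply: has_mean_le (has_meanD hW (has_meanZ 2 hU)).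
    apply: measurable_funM; first exact: has_mean_measurable (D0 t tt).
    by apply: measurable_funB.
  move=> w; rewrite -/(U w) /D.
  set x := W w - g t; set y := U w - g t.
  have -> : W w - U w = x - y by rewrite /x /y; ring.
  have h1 : 0 <= (x - y) ^+ 2 by rewrite sqr_ge0.
  have h2 : 0 <= (x + y) ^+ 2 by rewrite sqr_ge0.
  have h3 : 0 <= y ^+ 2 by rewrite sqr_ge0.
  rewrite ler_norml; apply/andP; split; nra.
have mug : measurable_fun setT (fun y => u y - g t) by exact: measurable_funB.
have hDU := has_mean_charge_orthogonal measurable_stat mug (D0 t tt) orth hc.
have := has_meanB (has_meanB hW hU) (has_meanZ 2 hDU).
rewrite mulr0 subr0 => hDD.
rewrite hU.2 hW.2 lee_fin -subr_ge0 -lee_fin -hDD.2.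
apply: integral_ge0 => w _; rewrite lee_fin.
rewrite [leRHS](_ : _ = D w ^+ 2); first by rewrite sqr_ge0.
by rewrite /D /U; ring.
Qed.

(** Relative to [t0], the density of the law under [t] is a function [h] of [stat], so it can be
    integrated against [k (stat w)] in place of the indicator of [A]. The version [k] obtained at
    [t0] therefore serves every [t]. *)
Lemma stat_sufficient : sufficient_statistic P X stat.
Proof.
split; first exact: is_statistic_stat.
move=> A sA; have mA := sample_events_measurable sA.
have tt0 := true_params1; set t0 : 'cV[R]_2 := const_mx 1 in tt0.
have mY := measurable_stat.
have [k [mk k0 kE]] := conditional_probability_exists (P t0) mY mA.
exists k => // t tt.
have [C C0 CE] := likelihood_ratioE tt0 tt.
pose e l := (power Ps t l)^-1 - (power Ps t0 l)^-1.
pose h (y : R * R) := C * expR (- (N%:R * y.1 * e ord0 + N%:R * y.2 * e ord_max)).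
have hE w : likelihood_ratio t0 t w = h (stat w) by rewrite CE sum_ord2.
have mh : measurable_fun [set: R * R] h.
  apply: measurable_funM => //; apply: measurableT_comp => //.
  apply: measurableT_comp => //; apply: measurable_funD.
    by apply: measurable_funM => //; exact: measurable_funM.
  by apply: measurable_funM => //; exact: measurable_funM.
have h0 y : 0 <= h y by rewrite mulr_ge0 ?expR_ge0// ltW.
have mstat B : measurable B -> measurable (stat @^-1` B).
  by move=> mB; rewrite -[X in measurable X]setTI; exact: mY.
have mkY : measurable_fun [set: T] (k \o stat) by exact: measurableT_comp.
have kY0 w : 0 <= (k \o stat) w by exact: k0.
have mA1 : measurable_fun [set: T] (\1_A : T -> R) by exact: measurable_indic.
have A10 w : 0 <= (\1_A w : R) by rewrite indicE.
have key B : measurable B ->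
    P t (A `&` stat @^-1` B) = (\int[P t]_w (\1_B (stat w) * k (stat w))%:E)%E.
  move=> mB; have mB1 : measurable_fun [set: R * R] (\1_B : R * R -> R).
    exact: measurable_indic.
  have mBh : measurable_fun [set: R * R] (fun y => \1_B y * h y) by exact: measurable_funM.
  have Bh0 y : 0 <= \1_B y * h y by rewrite mulr_ge0.
  have sAB : <<s sample_events X >> (A `&` stat @^-1` B).
    apply: (@measurableI _ (g_sigma_algebraType (sample_events X))) => //.
    exact: (is_statistic_stat mB).
  rewrite (likelihood_ratioP tt0 tt sAB) /mdensity/=.
  transitivity (\int[mdensity (P t0) mA1 A10]_w (\1_B (stat w) * h (stat w))%:E)%E.
    rewrite (ge0_integral_mdensity _ mA1 A10 (f := fun w => (\1_B (stat w) * h (stat w))%:E)).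
    - rewrite [LHS]integral_mkcond; apply: eq_integral => w _.
      rewrite patchE in_setI hE -EFinM !indicE.
      rewrite (_ : (w \in stat @^-1` B) = (stat w \in B)); last first.
        by apply/idP/idP; rewrite !inE.
      by case: (w \in A); case: (stat w \in B); rewrite ?mulr0 ?mul0r ?mulr1 ?mul1r.
    - by apply/measurable_EFinP; exact: (measurableT_comp mBh).
    - by move=> w; rewrite lee_fin Bh0.
  (* By the choice of [k], the measures of densities [\1_A] and [k \o stat] with respect to [P t0]
     have the same image under [stat]. *)
  transitivity (\int[mdensity (P t0) mkY kY0]_w (\1_B (stat w) * h (stat w))%:E)%E.
    apply: (@eq_ge0_integral_comp _ _ T _ R (mdensity (P t0) mA1 A10)
      (mdensity (P t0) mkY kY0) stat (fun y => (\1_B y * h y)%:E) mY) => [B' mB'||y].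
    - rewrite -[LHS]/(\int[P t0]_(w in stat @^-1` B') (\1_A w)%:E)%E.
      rewrite -[RHS]/(\int[P t0]_(w in stat @^-1` B') (k (stat w))%:E)%E.
      rewrite integral_indic//; last exact: mstat.
      etransitivity; first exact: (kE B' mB').
      rewrite [RHS]integral_mkcond; apply: eq_integral => w _.
      rewrite patchE indicE (_ : (w \in stat @^-1` B') = (stat w \in B')); last first.
        by apply/idP/idP; rewrite !inE.
      by case: (_ \in _); rewrite ?mul1r ?mul0r.
    - exact/measurable_EFinP.
    - by rewrite lee_fin.
  rewrite (ge0_integral_mdensity _ mkY kY0 (f := fun w => (\1_B (stat w) * h (stat w))%:E)).
  - rewrite (@ge0_integral_likelihood_ratio t0 t _ _ stat (fun y => \1_B y * k y))//.
    + by apply: eq_integral => w _; rewrite hE -EFinM /=; congr EFin; ring.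
    + exact: is_statistic_stat.
    + exact: measurable_funM.
    + by move=> y; rewrite mulr_ge0.
  - by apply/measurable_EFinP; exact: (measurableT_comp mBh).
  - by move=> w; rewrite lee_fin Bh0.
split.
  apply: (@ge0_integral_fin_integrable _ _ _ _ (k \o stat) (fine (P t A))) => //.
  rewrite fineK ?fin_num_measure//.
  have := key setT measurableT; rewrite preimage_setT setIT => ->.
  by apply: eq_integral => w _; rewrite indicE in_setT mul1r.
move=> B mB; rewrite key// [RHS]integral_mkcond; apply: eq_integral => w _.
rewrite patchE indicE (_ : (w \in stat @^-1` B) = (stat w \in B)); last first.
  by apply/idP/idP; rewrite !inE.
by case: (_ \in _); rewrite ?mul1r ?mul0r.
Qed.

(** * Maximum likelihood, outside a null event *)

Definition nonvanishing : set T :=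
  [set w | forall l i, ComplexField.Normc.normc (X w l i) != 0].

Lemma normc_coordinate l i w : ComplexField.Normc.normc (X w l i) ^+ 2 =
  coordinate (false, (l, i)) w ^+ 2 + coordinate (true, (l, i)) w ^+ 2.
Proof.
rewrite /coordinate/= /X; case: (received S H V w l i) => a b /=.
by rewrite /ComplexField.Normc.normc sqr_sqrtr ?addr_ge0 ?sqr_ge0.
Qed.

Lemma measurable_nonvanishing : measurable nonvanishing.
Proof.
pose F (li : 'I_2 * 'I_N) w :=
  coordinate (false, li) w ^+ 2 + coordinate (true, li) w ^+ 2.
have mF li : measurable_fun [set: T] (F li).
  by apply: measurable_funD; apply: measurable_funX; exact: measurable_coordinate.
rewrite (_ : nonvanishing = \bigcap_(li in [set: 'I_2 * 'I_N]) (F li @^-1` ~` [set 0])).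
  apply: fin_bigcap_measurable; first exact: finite_finset.
  move=> li _; rewrite -[X in measurable X]setTI; apply: mF => //.
  exact: measurableC.
apply/seteqP; split => w /=.
  move=> h [l i] _ /=; rewrite /F -normc_coordinate => /eqP.
  by rewrite expf_eq0/= (negbTE (h l i)).
move=> h l i; have := h (l, i) I; rewrite /= /F -normc_coordinate => /eqP.
by rewrite expf_eq0.
Qed.

(** Normal laws of positive deviation have no atom, so almost surely all coordinates are nonzero,
    which already forces all amplitudes to be nonzero. *)
Lemma probability_nonvanishingC t : true_params t -> P t (~` nonvanishing) = 0%E.
Proof.
move=> tt; pose E (j : coordinates) : set R := ~` [set 0].
have mE j : measurable (E j) by exact: measurableC.
have nE j : normal_prob 0 (std_dev t j) (E j) = 1%E.
  have n0 : normal_prob 0 (std_dev t j) [set (0 : R)] = 0%E.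
    have /null_content_dominatesP := normal_prob_dominates 0 (std_dev t j).
    by apply; [exact: measurable_set1|exact: lebesgue_measure_set1].
  etransitivity.
    exact: (@probability_setC _ _ _ (normal_prob 0 (std_dev t j)) _ (measurable_set1 0)).
  by rewrite [X in (1 - X)%E]n0 sube0.
pose G := [set w | forall j, E j (coordinate j w)].
have PG : P t G = 1%E.
  rewrite (coordinate_laws tt mE) big1// => j _; exact: nE.
have mG : measurable G.
  rewrite (_ : G = \bigcap_(j in [set: coordinates]) (coordinate j @^-1` E j)).
    apply: fin_bigcap_measurable; first exact: finite_finset.
    by move=> j _; rewrite -[X in measurable X]setTI; exact: measurable_coordinate.
  by apply/seteqP; split => w /= h j; [move=> _|]; exact: h.
have GC : P t (~` G) = 0%E by rewrite probability_setC// PG subee.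
apply/eqP; rewrite eq_le measure_ge0 andbT -GC; apply: le_measure.
- rewrite inE; apply: measurableC; exact: measurable_nonvanishing.
- by rewrite inE; exact: measurableC.
apply: subsetC => w Gw l i; rewrite -sqrf_eq0 normc_coordinate.
rewrite gt_eqF// ltr_wpDr ?sqr_ge0// lt_neqAle sqr_ge0 andbT eq_sym sqrf_eq0.
by apply/eqP; exact: (Gw (false, (l, i))).
Qed.

Lemma mean_square_gt0 w l : nonvanishing w -> 0 < mean_square (X w) l.
Proof.
move=> Gw; rewrite /mean_square mulr_gt0 ?invr_gt0 ?ltr0n ?muln_gt0//=.
rewrite (bigD1 (Ordinal N_gt0))//= ltr_wpDr//.
  by apply: sumr_ge0 => i _; exact: sqr_ge0.
by rewrite lt_neqAle sqr_ge0 andbT eq_sym sqrf_eq0 Gw.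
Qed.

(** In terms of [x = m / q] this is the [n]-th power of [x * expR (- x) <= expR (- 1)], that is of
    [x <= expR (x - 1)]. *)
Lemma likelihood_factor_le (A m q : R) (n : nat) : 0 < m -> 0 < q -> 0 <= A ->
  (q ^+ n)^-1 * A * expR (- (n%:R * m / q)) <=
  (m ^+ n)^-1 * A * expR (- (n%:R * m / m)).
Proof.
move=> m0 q0 A0.
have E (p : R) : (p ^+ n)^-1 * A * expR (- (n%:R * m / p)) =
    A * (p^-1 * expR (- (m / p))) ^+ n.
  have -> : - (n%:R * m / p) = n%:R * - (m / p) by ring.
  by rewrite expRM_natl exprMn exprVn [RHS]mulrCA mulrA.
rewrite !E divff ?gt_eqF//; apply: ler_wpM2l => //.
apply: lerXn2r;
  rewrite ?nnegrE ?mulr_ge0 ?expR_ge0 ?invr_ge0 ?(ltW m0) ?(ltW q0)//.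
apply: (@le_trans _ _ (m^-1 * (m / q * expR (- (m / q))))).
  by rewrite mulrA mulrA mulVf ?mul1r ?gt_eqF.
apply: ler_wpM2l; first by rewrite invr_ge0 ltW.
rewrite expRN ler_pdivrMr ?expR_gt0// -expRD.
by have := expR_ge1Dx (-1 + m / q); rewrite addrA subrr add0r.
Qed.

Lemma theta_hatE w : theta_hat Ps (X w) =
  params_of (mean_square (X w) ord0) (mean_square (X w) ord_max).
Proof.
apply/matrixP => k j; rewrite !mxE /sigma2H_hat /sigma2V_hat.
by case: ifP => _; rewrite mulrC.
Qed.

Lemma power_theta_hat w l : power Ps (theta_hat Ps (X w)) l = mean_square (X w) l.
Proof.
rewrite theta_hatE; have [E0 E1] := power_params_of
  (mean_square (X w) ord0) (mean_square (X w) ord_max).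
by case: (ord2P l) => ->.
Qed.

(** The powers of the estimate are the observed mean squares, so both factors of the likelihood are
    maximised separately and at once. Positivity of the mean squares puts the estimate in the
    domain. *)
Lemma theta_hat_ml w : nonvanishing w -> is_ml_estimate Ps (X w) (theta_hat Ps (X w)).
Proof.
move=> Gw; split=> [l|u hu]; first by rewrite power_theta_hat mean_square_gt0.
apply: ler_prod => l _; rewrite power_theta_hat.
have A0 : 0 <= \prod_(i < N) ComplexField.Normc.normc (X w l i).
  by apply: prodr_ge0 => i _; case: (X w l i) => a b; exact: sqrtr_ge0.
rewrite !mulr_ge0 ?expR_ge0 ?invr_ge0 ?exprn_ge0 ?(ltW (hu l))//=.
by apply: likelihood_factor_le; [exact: mean_square_gt0|exact: hu|exact: A0].
Qed.

Lemma theta_hat_ml_ae t : true_params t ->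
  {ae P t, forall w, is_ml_estimate Ps (X w) (theta_hat Ps (X w))}.
Proof.
move=> tt; exists (~` nonvanishing); split.
- apply: measurableC; exact: measurable_nonvanishing.
- exact: probability_nonvanishingC.
by apply: subsetC => w; exact: theta_hat_ml.
Qed.

(** * Score, Fisher information and the Cramer-Rao bound *)

Definition score_coef (t : 'cV[R]_2) (l : 'I_2) : R := N%:R / power Ps t l ^+ 2.

(** Matrix of the linear map from parameters to powers; its row [l] is [(Ps l, 1)]. *)
Definition power_mx : 'M[R]_2 := \matrix_(l, k) power Ps (delta_mx k ord0) l.

Lemma powerD t v (h : R) l : power Ps (h *: v + t) l = h * power Ps v l + power Ps t l.
Proof. by rewrite /power /sigma2H /sigma2V !mxE; ring. Qed.

(** As a function of the power [p], the logarithm of a factor is [- N ln p - N m / p] up to a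
    constant, with derivative [N (m - p) / p ^+ 2]. The chain rule contributes the power of the
    direction, an entry of [power_mx]. *)
Lemma score_nonvanishing t w (k : 'I_2) : true_params t -> nonvanishing w ->
  score Ps (X w) t k ord0 =
  \sum_(l < 2) power_mx l k * (score_coef t l * centered t l w).
Proof.
move=> tt Gw; rewrite mxE; set v := delta_mx k ord0.
pose f u := ln (likelihood Ps (X w) u).
pose A l := \prod_(i < N) ComplexField.Normc.normc (X w l i).
have A0 l : 0 < A l.
  apply: prodr_gt0 => i _; rewrite lt_neqAle eq_sym Gw/=.
  by case: (X w l i) => a b; exact: sqrtr_ge0.
pose p l := power Ps t l; pose q l := power Ps v l.
have p0 l : 0 < p l by exact: power_gt0.
(* Logarithm of the [l]-th factor of the likelihood along the line through [t] in direction [v]. *)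
pose psi l (h : R) := - N%:R * ln (h * q l + p l) + ln (A l) -
  N%:R * mean_square (X w) l * (h * q l + p l)^-1.
have -> : 'D_v f t = 'D_1 (fun h : R => f (h *: v + t)) 0.
  have E : (fun h : R => h^-1 *: ((f \o shift t) (h *: v) - f t)) =
      (fun h : R => h^-1 *: (((fun h : R => f (h *: v + t)) \o shift 0) (h *: 1) -
        (fun h : R => f (h *: v + t)) 0)).
    by apply/funext => h /=; rewrite addr0 scale0r add0r [h *: 1]mulr1.
  exact: (congr1 (fun F : R -> R => lim (F @ 0^')) E).
have near_pos l : \forall h \near (0 : R), 0 < h * q l + p l.
  have : (fun h : R => h * q l + p l) @ (0 : R) --> (0 * q l + p l).
    by apply: cvgD; [apply: cvgM; [exact: cvg_id|exact: cvg_cst]|exact: cvg_cst].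
  by rewrite mul0r add0r => /cvgr_gt; apply.
(* Only near 0: the logarithm splits as long as both powers stay positive. *)
have fE : \forall h \near (0 : R), f (h *: v + t) = psi ord0 h + psi ord_max h.
  near=> h.
  have hp l : 0 < h * q l + p l by case: (ord2P l) => ->; near: h; exact: near_pos.
  have F l : ln ((power Ps (h *: v + t) l ^+ N)^-1 * A l *
      expR (- (N%:R * mean_square (X w) l / power Ps (h *: v + t) l))) = psi l h.
    rewrite powerD -/(q l) -/(p l).
    rewrite lnM ?posrE ?mulr_gt0 ?invr_gt0 ?exprn_gt0 ?expR_gt0//.
    rewrite lnM ?posrE ?invr_gt0 ?exprn_gt0// lnV ?posrE ?exprn_gt0//.
    by rewrite lnXn// expRK /psi -mulr_natl; ring.
  have pos l : 0 < (power Ps (h *: v + t) l ^+ N)^-1 * A l *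
      expR (- (N%:R * mean_square (X w) l / power Ps (h *: v + t) l)).
    by rewrite powerD !mulr_gt0 ?invr_gt0 ?exprn_gt0 ?expR_gt0//; exact: hp.
  rewrite /f /likelihood big_ord_recl big_ord1.
  rewrite (_ : lift ord0 ord0 = ord_max); last exact: val_inj.
  by rewrite lnM ?posrE; [rewrite !F|exact: pos|exact: pos].
rewrite (near_eq_derive _ fE).
have dpsi l : is_derive (0 : R) 1 (psi l) (q l * (score_coef t l * centered t l w)).
  have pn : p l != 0 by rewrite gt_eqF.
  have daff : is_derive (0 : R) (1 : R) (fun h : R => h * q l + p l) (q l).
    have -> : (fun h : R => h * q l + p l) = (q l \*: id) + cst (p l).
      by apply/funext => h /=; rewrite mulrC.
    by apply: is_derive_eq; rewrite addr0 [_ *: _]mulr1.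
  have aff0 : 0 * q l + p l = p l by rewrite mul0r add0r.
  have dln : is_derive (0 : R) (1 : R) (fun h : R => ln (h * q l + p l)) ((p l)^-1 * q l).
    have := @is_derive1_comp R (@ln R) (fun h : R => h * q l + p l) 0 (p l)^-1 (q l).
    by rewrite aff0; apply => //; exact: is_derive1_ln.
  have dV : is_derive (0 : R) (1 : R) (fun h : R => (h * q l + p l)^-1)
      (- p l ^- 2 * q l).
    have := @is_deriveV R (fun h : R => h * q l + p l) 0 (q l) 1.
    by rewrite aff0 => /(_ pn daff).
  have -> : psi l = ((- N%:R) \*: (fun h : R => ln (h * q l + p l))) + cst (ln (A l)) -
      ((N%:R * mean_square (X w) l) \*: (fun h : R => (h * q l + p l)^-1)).
    by apply/funext => h.
  apply: is_derive_eq.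
  rewrite /score_coef /centered -/(p l) /GRing.scale/=.
  by field.
have -> : (fun h => psi ord0 h + psi ord_max h) = psi ord0 + psi ord_max by [].
rewrite sum_ord2 !mxE -/v -/(q ord0) -/(q ord_max).
have dp0 := dpsi ord0; have dp1 := dpsi ord_max.
by rewrite (@derive_val _ _ _ _ _ _ _ (is_deriveD dp0 dp1)).
Unshelve. all: by end_near. Qed.

(** A zero amplitude makes the likelihood 0 at every parameter, and [ln 0 = 0] makes its logarithm
    constant. *)
Lemma score_vanishing t w (k : 'I_2) : ~ nonvanishing w ->
  score Ps (X w) t k ord0 = 0.
Proof.
move=> /existsNP[l /existsNP[i /negP]]; rewrite negbK => /eqP xli.
rewrite mxE (_ : (fun u => _) = cst 0); first exact: derive_cst.
apply/funext => u; rewrite (_ : likelihood _ _ _ = 0) ?ln0//.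
rewrite /likelihood (bigD1 l)//= [X in _ * X * _](bigD1 i)//= xli.
by rewrite mul0r mulr0 mul0r mul0r.
Qed.

Definition centered_col t w : 'cV[R]_2 := \col_l centered t l w.

Definition score_diag t : 'M[R]_2 := diag_mx (\row_l score_coef t l).

Definition centered_cov t : 'M[R]_2 := diag_mx (\row_l (power Ps t l ^+ 2 / N%:R)).

Lemma scoreE t w : true_params t -> score Ps (X w) t =
  \1_nonvanishing w *: (power_mx^T *m score_diag t *m centered_col t w).
Proof.
move=> tt; apply/matrixP => k j; rewrite [j]ord1 [RHS]mxE indicE.
have [Gw|Gw] := pselect (nonvanishing w); last first.
  by rewrite score_vanishing// memNset// mul0r.
rewrite mem_set// mul1r score_nonvanishing// -mulmxA mxE; apply: eq_bigr => l _.
by rewrite [in RHS]mxE /score_diag mul_diag_mx !mxE.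
Qed.

Lemma powerE u l : power Ps u l = (power_mx *m u) l ord0.
Proof.
by rewrite mxE sum_ord2 !mxE /power /sigma2H /sigma2V !mxE/=; ring.
Qed.

Lemma power_mx_unit : power_mx \in unitmx.
Proof.
(* The columns of the inverse are the parameters whose powers are the two unit vectors. *)
pose B : 'M[R]_2 := \matrix_(k, l)
  params_of (l == ord0)%:R (l == ord_max)%:R k ord0.
suff /mulmx1_unit[] : power_mx *m B = 1%:M by [].
apply/matrixP => i j; rewrite [RHS]mxE.
have -> : (power_mx *m B) i j =
    power Ps (params_of (j == ord0)%:R (j == ord_max)%:R) i.
  by rewrite powerE !mxE; apply: eq_bigr => k _; rewrite [B _ _]mxE.
have [E0 E1] := power_params_of (j == ord0)%:R (j == ord_max)%:R.
by case: (ord2P i) => ->; rewrite ?E0 ?E1 eq_sym.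
Qed.

(** Multiplied by [power_mx], the estimate becomes the column of mean squares and [t] the column of
    powers. *)
Lemma theta_hat_error t w : theta_hat Ps (X w) - t =
  invmx power_mx *m centered_col t w.
Proof.
rewrite -[LHS](mulKmx power_mx_unit); congr (_ *m _).
apply/matrixP => l j; rewrite [j]ord1 mulmxBr mxE [X in _ + X]mxE -!powerE.
by rewrite power_theta_hat mxE.
Qed.

Lemma has_mean_outer t (M : 'M[R]_2) (i j : 'I_2) : true_params t ->
  has_mean (P t)
    (fun w => ((M *m centered_col t w) *m (M *m centered_col t w)^T) i j)
    ((M *m centered_cov t *m M^T) i j).
Proof.
move=> tt; have h : has_mean (P t) (fun w => \sum_(l < 2) \sum_(k < 2)
      (M i l * M j k) * (centered t l w * centered t k w))
    (\sum_(l < 2) \sum_(k < 2)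
      (M i l * M j k) * ((l == k)%:R * (power Ps t l ^+ 2 / N%:R))).
  apply: has_mean_sum => l; apply: has_mean_sum => k; apply: has_meanZ.
  exact: has_mean_centeredM.
move: h; congr has_mean.
  apply/funext => w; rewrite mxE big_ord1 [in RHS]mxE [X in _ * X]mxE.
  rewrite [X in _ * X]mxE mulr_suml; apply: eq_bigr => l _.
  by rewrite mulr_sumr; apply: eq_bigr => k _; rewrite !mxE; ring.
rewrite [RHS]mxE exchange_big/=; apply: eq_bigr => k _.
rewrite /centered_cov mul_mx_diag !mxE (bigD1 k)//= eqxx big1 => [|l lk].
  by rewrite addr0 (_ : true%:R = 1 :> R)//; ring.
by rewrite (negbTE lk) mul0r mulr0.
Qed.

Lemma has_mean_expected_mx t m n (F : T -> 'M[R]_(m, n)) (E : 'M[R]_(m, n)) :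
  (forall i j, has_mean (P t) (fun w => F w i j) (E i j)) ->
  integrable_mx (P t) F /\ expected_mx (P t) F = E.
Proof.
move=> FE; split=> [i j|]; first exact: (FE i j).1.
by apply/matrixP => i j; rewrite mxE (has_mean_expectation (FE i j)).
Qed.

(** As [C *m W = 1], the Fisher matrix [A^T W C W A] reduces to [A^T W A], whose inverse is the
    error covariance [A^-1 C A^-T]. The proof multiplies the two matrices, which also yields
    invertibility of the Fisher matrix. *)
Lemma theta_hat_attains t : true_params t ->
  attains_cramer_rao (P t) Ps X t (fun w => theta_hat Ps (X w)).
Proof.
move=> tt; set A := power_mx; set C := centered_cov t; set W := score_diag t.
have CW : C *m W = 1%:M.
  apply/matrixP => i j; rewrite /C /centered_cov mul_diag_mx !mxE.
  have [_|_] := eqVneq i j; last by rewrite mulr0n mulr0.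
  rewrite /= !mulr1n /score_coef; field.
  by rewrite gt_eqF ?power_gt0// NR_neq0.
have [i1 e1] : integrable_mx (P t) (fun w => score Ps (X w) t *m (score Ps (X w) t)^T) /\
    expected_mx (P t) (fun w => score Ps (X w) t *m (score Ps (X w) t)^T) =
    A^T *m W *m C *m (A^T *m W)^T.
  apply: has_mean_expected_mx => i j.
  have := has_mean_indic measurable_nonvanishing (probability_nonvanishingC tt)
    (has_mean_outer (A^T *m W) i j tt).
  congr has_mean; apply/funext => w; rewrite (scoreE w tt) -/A -/W.
  rewrite linearZ/= -scalemxAl -scalemxAr scalerA [RHS]mxE indicE.
  by case: (_ \in _); rewrite ?mulr1 ?mulr0.
have [i2 e2] : integrable_mx (P t) (fun w =>
      (theta_hat Ps (X w) - t) *m (theta_hat Ps (X w) - t)^T) /\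
    expected_mx (P t) (fun w =>
      (theta_hat Ps (X w) - t) *m (theta_hat Ps (X w) - t)^T) =
    invmx A *m C *m (invmx A)^T.
  apply: has_mean_expected_mx => i j.
  have := has_mean_outer (invmx A) i j tt.
  by congr has_mean; apply/funext => w; rewrite theta_hat_error.
have EF : (invmx A *m C *m (invmx A)^T) *m (A^T *m W *m C *m (A^T *m W)^T) = 1%:M.
  rewrite [(A^T *m W)^T]trmx_mul trmxK {2}/W /score_diag tr_diag_mx -/(score_diag t) -/W.
  rewrite -!mulmxA [(invmx A)^T *m _]mulmxA -trmx_mul mulmxV ?power_mx_unit//.
  rewrite trmx1 mul1mx [C *m (W *m _)]mulmxA CW mul1mx [C *m (W *m _)]mulmxA CW.
  by rewrite mul1mx mulVmx// power_mx_unit.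
have [_ uF] := mulmx1_unit EF.
rewrite /attains_cramer_rao /=; split => //; first by rewrite e1.
by rewrite e1 e2 -[LHS](mulmxK uF) EF mul1mx.
Qed.

(** * The two estimates as linear combinations of the mean squares *)

Let delta_neq0 : Ps ord0 - Ps ord_max != 0.
Proof. by rewrite gt_eqF// subr_gt0. Qed.

Lemma sigma2H_hat_mv : is_mv_estimate P X (@sigma2H R) (fun w => sigma2H_hat Ps (X w)).
Proof.
pose D := Ps ord0 - Ps ord_max.
have -> : (fun w => sigma2H_hat Ps (X w)) = (fun w =>
    D^-1 * mean_square (X w) ord0 + (- D^-1) * mean_square (X w) ord_max).
  by apply/funext => w; rewrite /sigma2H_hat -/D; ring.
apply: linear_mv_estimate => t; rewrite /power /D; field.
exact: delta_neq0.
Qed.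

Lemma sigma2V_hat_mv : is_mv_estimate P X (@sigma2V R) (fun w => sigma2V_hat Ps (X w)).
Proof.
pose D := Ps ord0 - Ps ord_max.
have -> : (fun w => sigma2V_hat Ps (X w)) = (fun w =>
    (- (D^-1 * Ps ord_max)) * mean_square (X w) ord0 +
    (D^-1 * Ps ord0) * mean_square (X w) ord_max).
  by apply/funext => w; rewrite /sigma2V_hat -/D; ring.
apply: linear_mv_estimate => t; rewrite /power /D; field.
exact: delta_neq0.
Qed.

End model.

Theorem theorem5 (R : realType) (d : measure_display) (T : measurableType d)
    (P : 'cV[R]_2 -> probability T R)
    (N : nat) (N_gt0 : (0 < N)%N)
    (Ps : 'I_2 -> R) (Ps2_ge0 : 0 <= Ps ord_max)
    (Ps_lt : Ps ord_max < Ps ord0)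
    (S : 'I_2 -> 'I_N -> R) (S_power : forall l i, `|S l i| ^+ 2 = Ps l)
    (H V : 'I_2 -> 'I_N -> T -> R[i])
    (H_gaussian : forall t, true_params t -> forall im l i,
       gaussian (P t) 0 (sigma2H t) (fun w => re_im im (H l i w)))
    (V_gaussian : forall t, true_params t -> forall im l i,
       gaussian (P t) 0 (sigma2V t) (fun w => re_im im (V l i w)))
    (HV_indep : forall t, true_params t ->
       mutually_independent (P t) (parts H V)) :
  let X := received S H V in
  let est w := theta_hat Ps (X w) in
  let stat w := (mean_square (X w) ord0, mean_square (X w) ord_max) in
  [/\ unbiased P (@sigma2H R) (fun w => sigma2H_hat Ps (X w)) /\
      unbiased P (@sigma2V R) (fun w => sigma2V_hat Ps (X w)),
      forall t, true_params t ->
        {ae P t, forall w, is_ml_estimate Ps (X w) (est w)},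
      is_mv_estimate P X (@sigma2H R) (fun w => sigma2H_hat Ps (X w)) /\
      is_mv_estimate P X (@sigma2V R) (fun w => sigma2V_hat Ps (X w)),
      forall t, true_params t -> attains_cramer_rao (P t) Ps X t est
    & sufficient_statistic P X stat /\ complete_statistic P X stat].
Proof.
move=> X est stat.
have mvH : is_mv_estimate P X (@sigma2H R) (fun w => sigma2H_hat Ps (X w)).
  exact: sigma2H_hat_mv.
have mvV : is_mv_estimate P X (@sigma2V R) (fun w => sigma2V_hat Ps (X w)).
  exact: sigma2V_hat_mv.
split.
  by case: mvH => _ uH _; case: mvV => _ uV _.
  by move=> t tt; exact: theta_hat_ml_ae.
  by [].
  by move=> t tt; exact: theta_hat_attains.
split.
  exact: (stat_sufficient N_gt0 S_power H_gaussian V_gaussian HV_indep).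
exact: (stat_complete N_gt0 Ps2_ge0 Ps_lt S_power H_gaussian V_gaussian HV_indep).
Qed.
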